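(* Let $n\ge1$ and let $\mathbb{F}$ be a field of characteristic zero or of characteristic $p>n$. For every $k\ge0$, the degree $k$ piece of $\mathbb{F}[\mathbf{x}_{n\times n}]/I_n$ has $\mathfrak{S}_n\times\mathfrak{S}_n$-module structure $$(\mathbb{F}[\mathbf{x}_{n\times n}]/I_n)_k\cong\bigoplus_{\substack{\lambda\vdash n\\ \lambda_1=n-k}}V^{\lambda}\otimes V^{\lambda}.$$
   Context: $\mathbb{F}[\mathbf{x}_{n\times n}]$ is the polynomial ring in variables $x_{i,j}$, $1\le i,j\le n$, graded by degree, with $\mathfrak{S}_n\times\mathfrak{S}_n$ acting by permuting row indices (first factor) and column indices (second factor) independently. $I_n$ is the homogeneous, $\mathfrak{S}_n\times\mathfrak{S}_n$-stable ideal generated by all products $x_{i,j}x_{i,j'}$ and $x_{i,j}x_{i',j}$ (all indices in $[n]$, including equal ones), all row sums $\sum_j x_{i,j}$ and all column sums $\sum_i x_{i,j}$. For a partition $\lambda\vdash n$, $V^\lambda$ is the irreducible $\mathfrak{S}_n$-module over $\mathbb{F}$ indexed by $\lambda$, and $\lambda_1$ is its largest part; $V^\lambda\otimes V^\lambda$ is the irreducible $\mathfrak{S}_n\times\mathfrak{S}_n$-module (outer tensor product). *)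

(* Defs.v *)
From HB Require Import structures.
From mathcomp Require Import all_boot all_order all_algebra all_fingroup.
From mathcomp Require Import all_solvable all_field all_character.
From mathcomp Require Import generic_quotient ring_quotient.
From mathcomp Require Import mpoly.
From mathcomp.classical Require Import boolp.

Set Implicit Arguments.
Unset Strict Implicit.
Unset Printing Implicit Defensive.

Import GRing.Theory.
Local Open Scope ring_scope.
Local Open Scope quotient_scope.

(* The n * n variables are numbered by mxvec_index : 'I_n -> 'I_n -> 'I_(n * n),
   which is a bijection (curry_mxvec_bij). *)
Notation mxpol F n := {mpoly F[n * n]}.

Section MatrixIdeal.

Variables (F : fieldType) (n : nat).

Definition xvar (i j : 'I_n) : mxpol F n := 'X_(mxvec_index i j).

Variant mxgen : mxpol F n -> Prop :=
| MxgenRow i j j' : mxgen (xvar i j * xvar i j')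
| MxgenCol i i' j : mxgen (xvar i j * xvar i' j)
| MxgenRowSum i : mxgen (\sum_j xvar i j)
| MxgenColSum j : mxgen (\sum_i xvar i j).

Definition mxideal : {pred mxpol F n} := fun p =>
  `[< exists2 s : seq (mxpol F n * mxpol F n),
        forall cg, cg \in s -> mxgen cg.2 & p = \sum_(cg <- s) cg.1 * cg.2 >].

Lemma mxidealP p :
  reflect (exists2 s : seq (mxpol F n * mxpol F n),
             forall cg, cg \in s -> mxgen cg.2 & p = \sum_(cg <- s) cg.1 * cg.2)
          (p \in mxideal).
Proof. exact: asboolP. Qed.

Lemma mxgen_ideal g : mxgen g -> g \in mxideal.
Proof.
move=> gen_g; apply/mxidealP; exists [:: (1, g)] => [cg|].
  by rewrite inE => /eqP->.
by rewrite big_seq1 mul1r.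
Qed.

Lemma mxideal_mull p q : q \in mxideal -> p * q \in mxideal.
Proof.
case/mxidealP=> s gen_s ->; apply/mxidealP.
exists [seq (p * cg.1, cg.2) | cg <- s] => [_ /mapP[cg /gen_s ? ->] //|].
by rewrite big_map mulr_sumr; apply: eq_bigr => cg _; rewrite mulrA.
Qed.

Lemma mxgen_coeff0 g : mxgen g -> g@_0%MM = 0.
Proof.
have x0 i j : (xvar i j)@_0%MM = 0.
  rewrite mcoeffX; case: eqP => // /(congr1 (@mdeg _)).
  by rewrite mdeg1 mdeg0.
case=> [i j j'|i i' j|i|j]; rewrite ?rmorphM /= ?x0 ?mul0r //.
all: by rewrite linear_sum big1 // => k _; exact: x0.
Qed.

Lemma mxideal_closed : idealr_closed mxideal.
Proof.
split=> [||p q r /(mxideal_mull p)].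
- by apply/mxidealP; exists [::] => //; rewrite big_nil.
- apply/negP => /mxidealP[s gen_s] /(congr1 (mcoeff 0%MM)) /eqP.
  rewrite mcoeff1 eqxx linear_sum big_seq big1 ?oner_eq0 // => cg /gen_s gen_cg.
  by rewrite /= rmorphM /= (mxgen_coeff0 gen_cg) mulr0.
case/mxidealP=> s gen_s -> /mxidealP[t gen_t ->]; apply/mxidealP.
exists (s ++ t) => [cg|]; last by rewrite big_cat.
by rewrite mem_cat => /orP[/gen_s|/gen_t].
Qed.

HB.instance Definition _ := isIdealr.Build _ mxideal mxideal_closed.

Definition mxquot := {ideal_quot mxideal}.
HB.instance Definition _ := Choice.on mxquot.
HB.instance Definition _ := GRing.ComNzRing.on mxquot.

Implicit Types (p : mxpol F n) (q : mxquot).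

Definition mxpi p : mxquot := \pi_{ideal_quot mxideal} p.

Lemma mxpiP q : {p | q = mxpi p}.
Proof. by exists (repr q); rewrite /mxpi reprK. Qed.

Lemma mxpiE p p' : (mxpi p = mxpi p') <-> (p - p' \in mxideal).
Proof. by rewrite Quotient.idealrBE; split=> [/eqP|/eqP]. Qed.

Lemma mxpi_is_zmod_morphism : zmod_morphism mxpi.
Proof. by move=> p p'; rewrite /mxpi !piE. Qed.
HB.instance Definition _ :=
  GRing.isZmodMorphism.Build _ _ mxpi mxpi_is_zmod_morphism.

Lemma mxpi_is_monoid_morphism : monoid_morphism mxpi.
Proof. by split=> [|p p']; rewrite /mxpi !piE. Qed.
HB.instance Definition _ :=
  GRing.isMonoidMorphism.Build _ _ mxpi mxpi_is_monoid_morphism.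

Definition mxquot_scale (a : F) q : mxquot := mxpi a%:MP * q.

Fact mxquot_scaleA a b q :
  mxquot_scale a (mxquot_scale b q) = mxquot_scale (a * b) q.
Proof. by rewrite /mxquot_scale mulrA -rmorphM /= mpolyCM. Qed.
Fact mxquot_scale1 : left_id 1 mxquot_scale.
Proof. by move=> q; rewrite /mxquot_scale mpolyC1 rmorph1 mul1r. Qed.
Fact mxquot_scaleDr : right_distributive mxquot_scale +%R.
Proof. by move=> a q q'; rewrite /mxquot_scale mulrDr. Qed.
Fact mxquot_scaleDl q : {morph mxquot_scale^~ q : a b / a + b}.
Proof. by move=> a b; rewrite /mxquot_scale mpolyCD rmorphD mulrDl. Qed.
HB.instance Definition _ := GRing.Zmodule_isLmodule.Build F mxquot
  mxquot_scaleA mxquot_scale1 mxquot_scaleDr mxquot_scaleDl.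

Lemma mxpiZ a p : mxpi (a *: p) = a *: mxpi p.
Proof. by rewrite -mul_mpolyC rmorphM. Qed.

Definition mxquot_degree (k : nat) q : Prop :=
  exists2 p : mxpol F n, p \is k.-homog & q = mxpi p.

(* MathComp permutations compose from left to right, so that
   x_(i, j) |-> x_(g.1 i, g.2 j) is a right action, as is the action
   v |-> v *m rG g of a matrix representation rG on row vectors. *)
Definition mxact (g : 'S_n * 'S_n) p : mxpol F n :=
  p \mPo [tuple mxvec (\matrix_(i, j) xvar (g.1 i) (g.2 j)) 0 k | k < n * n].

HB.instance Definition _ g := GRing.Linear.copy (mxact g)
  (comp_mpoly [tuple mxvec (\matrix_(i, j) xvar (g.1 i) (g.2 j)) 0 k | k < n * n]).
HB.instance Definition _ g := GRing.RMorphism.copy (mxact g)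
  (comp_mpoly [tuple mxvec (\matrix_(i, j) xvar (g.1 i) (g.2 j)) 0 k | k < n * n]).

(* Computed on a representative; see mxquot_act_pi for independence. *)
Definition mxquot_act (g : 'S_n * 'S_n) q : mxquot := mxpi (mxact g (repr q)).

Lemma mxact_x g i j : mxact g (xvar i j) = xvar (g.1 i) (g.2 j).
Proof.
by rewrite /mxact /xvar comp_mpolyXU -tnth_nth tnth_mktuple mxvecE mxE.
Qed.

Lemma mxact_gen g p : mxgen p -> mxgen (mxact g p).
Proof.
case=> [i j j'|i i' j|i|j].
- by rewrite rmorphM /= !mxact_x; exact: MxgenRow.
- by rewrite rmorphM /= !mxact_x; exact: MxgenCol.
- rewrite rmorph_sum /=; under eq_bigr do rewrite mxact_x.
  have -> : \sum_j xvar (g.1 i) (g.2 j) = \sum_j xvar (g.1 i) j.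
    by rewrite [RHS](reindex_perm g.2).
  by constructor.
- rewrite rmorph_sum /=; under eq_bigr do rewrite mxact_x.
  have -> : \sum_i xvar (g.1 i) (g.2 j) = \sum_i xvar i (g.2 j).
    by rewrite [RHS](reindex_perm g.1).
  by constructor.
Qed.

Lemma mxact_ideal g p : p \in mxideal -> mxact g p \in mxideal.
Proof.
case/mxidealP=> s gen_s ->; apply/mxidealP.
exists [seq (mxact g cg.1, mxact g cg.2) | cg <- s] => [_ /mapP[cg /gen_s ? ->]|].
  exact: mxact_gen.
by rewrite big_map rmorph_sum; apply: eq_bigr => cg _; rewrite rmorphM.
Qed.

Lemma mxquot_act_pi g p : mxquot_act g (mxpi p) = mxpi (mxact g p).
Proof.
apply/mxpiE; rewrite -raddfB.
by apply/mxact_ideal/mxpiE; rewrite /mxpi reprK.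
Qed.

End MatrixIdeal.

Section Partitions.

Variable n : nat.

(* Partitions of n, padded with zeros up to length n. *)
Definition intpart :=
  {la : n.-tuple 'I_n.+1 |
    sorted geq (map val la) && (sumn (map val la) == n)}.

Definition parts (la : intpart) : seq nat := map val (val la).

Definition largest_part (la : intpart) : nat := head 0%N (parts la).

(* The Young diagram of la is filled with 0, ..., n - 1 row after row: the
   entry i is in row reshape_index (parts la) i and in column
   reshape_offset (parts la) i. *)
Definition row_stab (la : intpart) : {set 'S_n} :=
  [set s : 'S_n | [forall i : 'I_n,
     reshape_index (parts la) (s i) == reshape_index (parts la) i]].

Definition col_stab (la : intpart) : {set 'S_n} :=
  [set s : 'S_n | [forall i : 'I_n,
     reshape_offset (parts la) (s i) == reshape_offset (parts la) i]].

End Partitions.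

Section Irreducibles.

Variables (F : fieldType) (n : nat).

Local Notation regS := (regular_repr F [set: 'S_n]%G).

Definition young_symmetrizer (la : intpart n) :=
  gring_row ((\sum_(s in row_stab la) regS s)
             *m (\sum_(t in col_stab la) (-1) ^+ odd_perm t *: regS t)).

(* V^la is the right ideal of the group algebra F[S_n] generated by the Young
   symmetrizer of la; it is irreducible when the characteristic of F is 0 or
   larger than n, and trivial for la = (n). *)
Definition irrS (la : intpart n) : representation F [set: 'S_n]%G :=
  Representation
    (submod_repr (cyclic_mx_module regS (young_symmetrizer la))).

Lemma outer_mx_repr (rG1 rG2 : representation F [set: 'S_n]%G) :
  mx_repr [set: 'S_n * 'S_n]%G (fun g => tprod (rG1 g.1) (rG2 g.2)).
Proof.
split=> [|g h _ _]; first by rewrite !repr_mx1 tprod1.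
by rewrite !repr_mxM ?inE // tprodE.
Qed.

Definition outer_repr rG1 rG2 : representation F [set: 'S_n * 'S_n]%G :=
  Representation (MxRepresentation (outer_mx_repr rG1 rG2)).

End Irreducibles.

(* Main.v *)
(* Let Q_k be the degree k piece of the quotient and A the group algebra of S_n,
   realized by the matrices of its regular representation, where transposition
   is the anti-involution s |-> s^-1. Write e = a b for the Young symmetrizer of
   la, with a the row symmetrizer and b the column antisymmetrizer.

   Counting conjugacy classes shows that A is the sum of the ideals A e A. As a
   monomial with two variables in a common row or column vanishes, Q_k is
   spanned by the translates of the monomial R_0 = prod_(i >= n - k) x_(i, i), so
   it is the sum of the images of Q_k (e_la (X) e_mu) under A (X) A.

   Let h be the symmetrizer of the first n - k indices; R_0 is invariant under it
   on either side. If mu_1 < n - k then h A b_mu = 0. If mu_1 > n - k, the row sum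
   relations turn the symmetrization of a rook monomial over mu_1 columns into
   products of k variables lying in fewer than k columns, hence into 0. The same
   rewriting gives R_0 (1 (X) y h) = R_0 (y^T h (X) 1); for mu_1 = n - k, where h e_mu
   is a multiple of e_mu, it identifies R_0 (x e_la (X) y e_mu) with a multiple of
   R_0 (e_mu^T z e_la (X) e_mu), and e_mu^T A e_la is 0 for la <> mu and the line
   spanned by b_mu e_mu for la = mu. So Q_k is the sum of the images of the
   V^la (X) V^la with la_1 = n - k.

   These images are nonzero: evaluating polynomials at the permutation matrices w
   sends p to sum_w p(w) w in A; after multiplication by b_la with la_1 = n - k this
   kills all polynomials of degree less than k, hence the degree k part of the
   ideal. The orthogonality of the e_la then makes their sum direct. *)

From HB Require Import structures.
Require Import Defs.
From mathcomp Require Import all_boot all_order all_algebra all_fingroup.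
From mathcomp Require Import all_solvable all_field all_character.
From mathcomp Require Import mpoly.
From mathcomp.classical Require Import boolp.

Set Implicit Arguments.
Unset Strict Implicit.
Unset Printing Implicit Defensive.

Import GRing.Theory.
Local Open Scope ring_scope.

(** * Young diagrams *)

Section Tableaux.

Variable n : nat.
Implicit Types la mu : intpart n.

Definition cell_row la (i : nat) := reshape_index (parts la) i.
Definition cell_col la (i : nat) := reshape_offset (parts la) i.

Lemma size_parts la : size (parts la) = n.
Proof. by rewrite size_map size_tuple. Qed.

Lemma sumn_parts la : sumn (parts la) = n.
Proof. by have /andP[_ /eqP] := valP la. Qed.

Lemma sorted_parts la : sorted geq (parts la).
Proof. by have /andP[] := valP la. Qed.

Lemma parts_nonincr la r s :
  (r <= s)%N -> (nth 0 (parts la) s <= nth 0 (parts la) r)%N.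
Proof.
move=> le_rs; case: (ltnP s (size (parts la))) => [lt_s|le_s]; last first.
  by rewrite nth_default.
have tr : transitive geq by move=> y x z /= h1 h2; exact: leq_trans h2 h1.
apply: (sorted_leq_nth tr (fun x => leqnn x) 0%N (sorted_parts la)) => //.
exact: leq_ltn_trans lt_s.
Qed.

Lemma cell_col_lt la (i : 'I_n) :
  (cell_col la i < nth 0 (parts la) (cell_row la i))%N.
Proof. by apply: reshape_offsetP; rewrite sumn_parts. Qed.

Lemma cell_col_largest la (i : 'I_n) : (cell_col la i < largest_part la)%N.
Proof.
by apply: leq_trans (cell_col_lt la i) _; rewrite /largest_part -nth0 parts_nonincr.
Qed.

Lemma cell_exists la r c : (c < nth 0 (parts la) r)%N ->
  exists i : 'I_n, cell_row la i = r /\ cell_col la i = c.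
Proof.
move=> lt_c; have lt_i := flatten_indexP lt_c; rewrite sumn_parts in lt_i.
exists (Ordinal lt_i); rewrite /cell_row /cell_col /=.
by rewrite flatten_indexKl ?flatten_indexKr.
Qed.

Lemma cell_inj la (i j : 'I_n) :
  cell_row la i = cell_row la j -> cell_col la i = cell_col la j -> i = j.
Proof.
move=> er ec; apply: val_inj; rewrite /= -(reshape_indexK (parts la) i).
by rewrite -(reshape_indexK (parts la) j) -/(cell_row la i) er -/(cell_col la i) ec.
Qed.

Lemma cell_row_first la (i : nat) :
  (i < largest_part la)%N -> cell_row la i = 0%N.
Proof.
rewrite /largest_part -nth0 => lt_i; have := flatten_indexKl lt_i.
by rewrite /flatten_index take0.
Qed.

Lemma largest_part_le la : (largest_part la <= n)%N.
Proof.
by rewrite -{2}(sumn_parts la) /largest_part; case: (parts la) => //= a s; rewrite leq_addr.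
Qed.

(** The condition of von Neumann's combinatorial lemma. When it fails, some transposition of the row
    group of [la] becomes, conjugated by [g], an element of the column group of [mu], and products
    of symmetrizers vanish. *)
Definition collision_free la mu (g : 'S_n) := forall i j : 'I_n,
  cell_row la i = cell_row la j -> cell_col mu (g i) = cell_col mu (g j) -> i = j.

(** If [j] is at most the length of row [r], the right side is [j], and the left side counts entries
    with distinct columns below [j]; otherwise the right side counts the whole row. *)
Lemma collision_free_row_le la mu g r j : collision_free la mu g ->
  (#|[set i : 'I_n | (cell_row la i == r) && (cell_col mu (g i) < j)]|
   <= #|[set i : 'I_n | (cell_row la i == r) && (cell_col la i < j)]|)%N.
Proof.
move=> freeg; case: (leqP j (nth 0 (parts la) r)) => [le_j|lt_j]; last first.
  apply/subset_leq_card/subsetP => i; rewrite !inE => /andP[/eqP ri _].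
  by rewrite ri eqxx (leq_trans (cell_col_lt la i)) // ri ltnW.
apply: (@leq_trans j).
  set A := [set i | _].
  rewrite cardE -(size_map (fun i => cell_col mu (g i))) -[leqRHS](size_iota 0).
  apply: uniq_leq_size => [|_ /mapP[i + ->]]; last first.
    by rewrite mem_enum inE mem_iota => /andP[].
  rewrite map_inj_in_uniq ?enum_uniq // => x y; rewrite !mem_enum !inE.
  by move=> /andP[/eqP rx _] /andP[/eqP ry _]; apply: freeg; rewrite rx ry.
set A := [set i | _].
rewrite cardE -(size_map (cell_col la \o @nat_of_ord n)) -[leqLHS](size_iota 0).
apply: uniq_leq_size => [|c]; first exact: iota_uniq.
rewrite mem_iota /= add0n => lt_c.
have [i [ri ci]] := cell_exists (leq_trans lt_c le_j).
by apply/mapP; exists i => //; rewrite mem_enum inE ri ci eqxx.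
Qed.

Lemma card_by_rows la (P : pred 'I_n) :
  #|[set i | P i]| = (\sum_(r < n) #|[set i : 'I_n | (cell_row la i == r) && P i]|)%N.
Proof.
have row_lt (i : 'I_n) : (cell_row la i < n)%N.
  by have := @reshape_indexP (parts la) i; rewrite sumn_parts size_parts; apply.
rewrite -sum1_card (partition_big (fun i => Ordinal (row_lt i)) xpredT) //=.
apply: eq_bigr => r _; rewrite -sum1_card; apply: eq_bigl => i.
by rewrite !inE andbC -val_eqE.
Qed.

Lemma card_perm_col mu (g : 'S_n) j :
  #|[set i : 'I_n | cell_col mu (g i) < j]%N| = #|[set i : 'I_n | cell_col mu i < j]%N|.
Proof.
rewrite -(card_imset _ (@perm_inj _ g)); congr (#|pred_of_set _|).
apply/setP=> i; apply/imsetP/idP => [[k + ->]|]; rewrite ?inE // => ci.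
by exists (g^-1 i)%g; rewrite ?inE permKV.
Qed.

(** Summation over the rows gives dominance: the conjugate of [mu] is dominated by that of [la]. *)
Lemma collision_free_le la mu g j : collision_free la mu g ->
  (#|[set i : 'I_n | cell_col mu i < j]| <= #|[set i : 'I_n | cell_col la i < j]|)%N.
Proof.
move=> freeg; rewrite -(card_perm_col mu g) !(card_by_rows la).
by apply: leq_sum => r _; exact: collision_free_row_le.
Qed.

(** Both sides of the row inequality have the same sum over all rows because [g] is bijective, so
    equality holds in every row. With [j] the length of the row of [i], the whole row must then go
    to columns below [j]. *)
Lemma collision_free_col_lt la g : collision_free la la g ->
  forall i : 'I_n, (cell_col la (g i) < nth 0 (parts la) (cell_row la i))%N.
Proof.
move=> freeg i; set j := nth _ _ _.
have row_lt : (cell_row la i < n)%N.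
  by have := @reshape_indexP (parts la) i; rewrite sumn_parts size_parts; apply.
have le_r r := @collision_free_row_le la la g r j freeg.
have := card_perm_col la g j; rewrite !(card_by_rows la) => eq_sum.
have [_] := leqif_sum (P := xpredT) (fun (r : 'I_n) _ => leqif_eq (le_r r)).
rewrite /= eq_sum eqxx => /esym/forallP/(_ (Ordinal row_lt)).
rewrite /= => eq_r.
have : i \in [set k : 'I_n | (cell_row la k == cell_row la i) && (cell_col la k < j)%N].
  by rewrite inE eqxx cell_col_lt.
suff -> : [set k : 'I_n | (cell_row la k == cell_row la i) && (cell_col la k < j)%N]
        = [set k : 'I_n | (cell_row la k == cell_row la i) && (cell_col la (g k) < j)%N].
  by rewrite inE => /andP[].
apply/esym/eqP; rewrite eqEcard (eqP eq_r) leqnn andbT.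
apply/subsetP => k; rewrite !inE => /andP[/eqP rk _].
by rewrite rk eqxx /j -rk cell_col_lt.
Qed.

(** Von Neumann's lemma. [s] moves each [i] within its row to the column of [g i]; that cell exists
    by [collision_free_col_lt], and [s] is injective since [g] is collision-free. The remaining
    factor preserves columns. *)
Lemma collision_free_split la g : collision_free la la g ->
  exists s t : 'S_n, [/\ s \in row_stab la, t \in col_stab la & g = (s * t)%g].
Proof.
move=> freeg; have lt_g := collision_free_col_lt freeg.
have cellP (i : 'I_n) : {k : 'I_n | (cell_row la k == cell_row la i)
                        && (cell_col la k == cell_col la (g i))}.
  by apply: sigW; have [k [rk ck]] := cell_exists (lt_g i); exists k; rewrite rk ck !eqxx.
pose f i := sval (cellP i).
have rf i : cell_row la (f i) = cell_row la i.
  by rewrite /f; case: (cellP i) => k /= /andP[/eqP].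
have cf i : cell_col la (f i) = cell_col la (g i).
  by rewrite /f; case: (cellP i) => k /= /andP[_ /eqP].
have f_inj : injective f.
  move=> i j eq_f; apply: freeg; first by rewrite -(rf i) -(rf j) eq_f.
  by rewrite -(cf i) -(cf j) eq_f.
exists (perm f_inj), ((perm f_inj)^-1 * g)%g; split; last by rewrite mulKVg.
  by rewrite inE; apply/forallP => i; rewrite permE; apply/eqP/rf.
rewrite inE; apply/forallP => i; rewrite permM -/(cell_col _ _) -cf.
by rewrite -(permE f_inj) permKV.
Qed.

(** As the parts weakly decrease, the [find] is the number of parts exceeding [j], that is, the
    length of column [j]. *)
Lemma lt_nth_parts la j r :
  (j < nth 0 (parts la) r)%N = (r < find (fun p => p <= j)%N (parts la))%N.
Proof.
set m := find _ _; apply/idP/idP => [lt_j|lt_r]; last first.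
  by rewrite ltnNge (before_find 0%N lt_r).
rewrite ltnNge; apply/negP => le_m.
have has_p : has (fun p => p <= j)%N (parts la).
  rewrite has_find; apply: leq_ltn_trans le_m _; rewrite ltnNge.
  by apply: contraTN lt_j => le_s; rewrite nth_default.
have := nth_find 0%N has_p; rewrite -/m leqNgt => /negP; apply.
exact: leq_trans lt_j (parts_nonincr la le_m).
Qed.

Lemma card_col la j : #|[set i : 'I_n | cell_col la i == j]|
  = find (fun p => p <= j)%N (parts la).
Proof.
set m := find _ _.
rewrite cardE -(size_map (cell_row la \o @nat_of_ord n)).
rewrite -[RHS](size_iota 0); apply/perm_size/uniq_perm; last first.
- move=> r; rewrite mem_iota /= add0n -lt_nth_parts; apply/mapP/idP => [[i + ->]|lt_j].
    by rewrite mem_enum inE => /eqP <-; exact: cell_col_lt.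
  have [i [ri ci]] := cell_exists lt_j.
  by exists i => //; rewrite mem_enum inE ci.
- exact: iota_uniq.
rewrite map_inj_in_uniq ?enum_uniq // => x y; rewrite !mem_enum !inE.
by move=> /eqP cx /eqP cy /= rxy; apply: (cell_inj rxy); rewrite cx.
Qed.

(** Consecutive differences of the counts give the column lengths, and the conjugate partition
    determines the partition. *)
Lemma parts_from_cols la mu :
  (forall j, #|[set i : 'I_n | cell_col la i < j]%N|
           = #|[set i : 'I_n | cell_col mu i < j]%N|) ->
  la = mu.
Proof.
move=> eq_c.
have eq_j j : find (fun p => p <= j)%N (parts la) = find (fun p => p <= j)%N (parts mu).
  rewrite -!card_col.
  have split_card ka : #|[set i : 'I_n | cell_col ka i < j.+1]%N|
     = (#|[set i : 'I_n | cell_col ka i == j]| + #|[set i : 'I_n | cell_col ka i < j]%N|)%N.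
    rewrite -cardsUI [X in (_ + #|pred_of_set X|)%N](_ : _ = set0) ?cards0 ?addn0.
      by apply: eq_card => i; rewrite !inE ltnS leq_eqVlt.
    by apply/setP=> i; rewrite !inE; case: eqP => // ->; rewrite ltnn.
  by apply/eqP; rewrite -(eqn_add2r #|[set i : 'I_n | cell_col la i < j]%N|)
     -split_card eq_c split_card eq_c.
apply/val_inj/val_inj/(inj_map val_inj) => /=; rewrite -!/(parts _).
apply: (@eq_from_nth _ 0%N) => [|r _]; first by rewrite !size_parts.
apply/eqP; rewrite eqn_leq; apply/andP; split; rewrite leqNgt lt_nth_parts.
  by rewrite eq_j -lt_nth_parts ltnn.
by rewrite -eq_j -lt_nth_parts ltnn.
Qed.

Lemma collision la mu g : ~ collision_free la mu g ->
  exists i j : 'I_n, [/\ i != j, cell_row la i = cell_row la j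
                        & cell_col mu (g i) = cell_col mu (g j)].
Proof.
move=> nfree; apply: contrapT => nex; apply: nfree => i j rij cij.
apply/eqP; apply: contrapT => /negP nij; apply: nex.
by exists i, j.
Qed.

(** Collision-free permutations in both directions would give dominance both ways, hence equal
    shapes. *)
Lemma collision_neq la mu : la <> mu ->
  (forall g, ~ collision_free la mu g) \/ (forall g, ~ collision_free mu la g).
Proof.
move=> neq; apply: contrapT => /not_orP[/existsNP[g /contrapT fg] /existsNP[h /contrapT fh]].
apply: neq; apply: parts_from_cols => j; apply/eqP; rewrite eqn_leq.
by rewrite (collision_free_le j fh) (collision_free_le j fg).
Qed.

End Tableaux.

(** * Cycle types *)

Section CycleType.

(** Serves to match the orbits of two permutations with the same orbit sizes. *)
Lemma perm_eq_map_inj (T : eqType) (f : T -> nat) (s1 s2 : seq T) :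
  uniq s1 -> uniq s2 -> perm_eq (map f s1) (map f s2) ->
  exists2 b : T -> T, {in s1, forall x, b x \in s2 /\ f (b x) = f x}
                    & {in s1 &, injective b}.
Proof.
elim: s1 s2 => [|x s1 IHs] s2 /=; first by exists id.
case/andP=> xs1 uniq1 uniq2 eq12.
have /mapP[y ys2 fxy] : f x \in map f s2 by rewrite -(perm_mem eq12) mem_head.
have [|||b b_s2 b_inj] := IHs (rem y s2) => //; first exact: rem_uniq.
  rewrite -(perm_cons (f x)) (permPl eq12) fxy -map_cons.
  exact/perm_map/perm_to_rem.
have by_neq z : z \in s1 -> (b z == y) = false.
  by move=> /b_s2[]; rewrite mem_rem_uniq // inE => /andP[/negPf].
have neq_x z : z \in s1 -> (z == x) = false.
  by move=> zs1; apply: contraNF xs1 => /eqP <-.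
exists (fun z => if z == x then y else b z) => [z|z1 z2].
  rewrite inE; case: eqP => [-> //|_ /= /b_s2[bz ->]].
  by rewrite (mem_rem bz).
rewrite !inE; do 2![case: eqVneq => [->|_] /=] => //.
- by move=> _ z2s /esym/eqP; rewrite by_neq.
- by move=> z1s _ /eqP; rewrite by_neq.
- exact: b_inj.
Qed.

Variables (n : nat) (i0 : 'I_n).

(** Whether two powers agree at [x] depends only on the orbit length, so such equalities transfer to
    another permutation with an orbit of the same size. *)
Lemma expg_porbit_mod (s : 'S_n) x i j :
  ((s ^+ i)%g x == (s ^+ j)%g x) = (i == j %[mod #|porbit s x|]).
Proof.
have m_gt0 : (0 < #|porbit s x|)%N by rewrite lt0n card_porbit_neq0.
have mod_iter k : (s ^+ k)%g x = nth x (traject s x #|porbit s x|) (k %% #|porbit s x|).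
  rewrite nth_traject ?ltn_pmod // permX {1}(divn_eq k #|porbit s x|) addnC iterD.
  by congr (iter _ _ _); elim: (k %/ _)%N => // d IHd; rewrite mulSn iterD IHd iter_porbit.
by rewrite !mod_iter nth_uniq ?size_traject ?ltn_pmod ?uniq_traject_porbit.
Qed.

Definition orbit_sizes (s : 'S_n) := [seq #|A| | A : {set 'I_n} <- enum (porbits s)].

(** With orbits of equal size matched by [b] and base points [z], [w] chosen in them, [f] sends the
    k-th iterate of [z] under [s] to the k-th iterate of [w] under [t]. Equal orbit lengths make [f]
    injective and equivariant, so it conjugates [s] into [t]. *)
Lemma perm_orbit_sizes_conjg (s t : 'S_n) :
  perm_eq (orbit_sizes s) (orbit_sizes t) -> exists u, t = (s ^ u)%g.
Proof.
case/perm_eq_map_inj => [||b b_orb b_inj]; try exact: enum_uniq.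
have orbP (p : 'S_n) x : porbit p x \in enum (porbits p) by rewrite mem_enum imset_f.
(* Orbits are nonempty, so the default [i0] is never taken on them. *)
pose r (A : {set 'I_n}) := odflt i0 [pick z in A].
have rP (p : 'S_n) A : A \in enum (porbits p) -> porbit p (r A) = A.
  rewrite mem_enum => /imsetP[x _ ->]; rewrite /r; case: pickP => [z|/(_ x)].
    by rewrite -eq_porbit_mem => /eqP.
  by rewrite porbit_id.
pose z x := r (porbit s x).
have zP x : porbit s (z x) = porbit s x by apply: rP.
have kP x : {k | x = (s ^+ k)%g (z x)}.
  by apply: cid; apply/porbitP; rewrite -eq_porbit_mem zP.
pose k x := sval (kP x); have kE x : x = (s ^+ k x)%g (z x) by exact: svalP (kP x).
pose w x := r (b (porbit s x)).
have wP x : porbit t (w x) = b (porbit s x) by apply: rP; case: (b_orb _ (orbP s x)).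
have card_w x : #|porbit t (w x)| = #|porbit s (z x)|.
  by rewrite wP zP; case: (b_orb _ (orbP s x)).
pose f x := (t ^+ k x)%g (w x).
have f_inj : injective f.
  move=> x y eq_f.
  have eq_o : porbit s x = porbit s y.
    apply: b_inj => //; rewrite -!wP -(porbit_perm t (k x)) -/(f x) eq_f.
    exact: porbit_perm.
  have eq_w : w x = w y by rewrite /w eq_o.
  have eq_z : z x = z y by rewrite /z eq_o.
  have /eqP := eq_f; rewrite /f eq_w expg_porbit_mod card_w -expg_porbit_mod.
  by rewrite -kE -eq_z -kE => /eqP.
have f_st x : f (s x) = t (f x).
  have eq_o : porbit s (s x) = porbit s x by have := porbit_perm s 1 x; rewrite expg1.
  have eq_w : w (s x) = w x by rewrite /w eq_o.
  have eq_z : z (s x) = z x by rewrite /z eq_o.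
  have -> : t (f x) = (t ^+ (k x).+1)%g (w x) by rewrite expgSr permM.
  apply/eqP; rewrite /f eq_w expg_porbit_mod card_w -expg_porbit_mod -{1}eq_z -kE.
  by rewrite expgSr permM -kE.
exists (perm f_inj); apply/permP => x.
rewrite /conjg !permM -{1}[x](permKV (perm f_inj)).
by set y := (perm f_inj)^-1%g x; rewrite !permE f_st.
Qed.

Lemma intpart_of_seq (l : seq nat) : sumn l = n -> all (leq 1) l ->
  exists la : intpart n, parts la = sort geq l ++ nseq (n - size l) 0%N.
Proof.
move=> sum_l pos_l; set l' := _ ++ _.
have size_l : (size l <= n)%N.
  rewrite -sum_l; elim: (l) pos_l => //= a s IHs /andP[a_gt0 /IHs le_s].
  by rewrite -add1n leq_add.
have size_l' : size l' = n by rewrite size_cat size_sort size_nseq subnKC.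
have sum_l' : sumn l' = n.
  rewrite sumn_cat sumn_nseq mul0n addn0 -sum_l; apply: perm_sumn.
  by rewrite perm_sort.
have mem_le x : x \in l' -> (x <= n)%N.
  by move=> /perm_to_rem/perm_sumn; rewrite sum_l' /= => ->; rewrite leq_addr.
pose u : n.-tuple 'I_n.+1 := [tuple inord (nth 0%N l' i) | i < n].
have u_val : map val u = l'.
  apply: (@eq_from_nth _ 0%N) => [|i]; first by rewrite size_map size_tuple.
  rewrite size_map size_tuple => lt_i; rewrite (nth_map ord0) ?size_tuple //.
  rewrite -(tnth_nth ord0 u (Ordinal lt_i)) tnth_mktuple /= inordK // ltnS.
  by rewrite mem_le // mem_nth // size_l'.
have u_part : sorted geq (map val u) && (sumn (map val u) == n).
  rewrite u_val sum_l' eqxx andbT /l'.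
  have tr : transitive geq by move=> y x z /= h1 h2; exact: leq_trans h2 h1.
  rewrite sorted_pairwise // pairwise_cat -!sorted_pairwise //.
  rewrite sort_sorted ?andbT; last by move=> x y; exact: leq_total.
  apply/andP; split.
    by apply/allrelP => x y _; rewrite mem_nseq => /andP[_ /eqP->].
  by elim: (n - size l)%N => //= -[].
by exists (Sub u u_part); rewrite /parts SubK.
Qed.

(** Bounds the number of conjugacy classes by the number of partitions, the count behind
    [galg_annihilator0]. *)
Lemma cycle_type_exists : exists ty : 'S_n -> intpart n,
  forall s t, ty s = ty t -> exists u, t = (s ^ u)%g.
Proof.
have pos s : all (leq 1) (orbit_sizes s).
  apply/allP => _ /mapP[A + ->]; rewrite mem_enum => /imsetP[x _ ->].
  by rewrite lt0n card_porbit_neq0.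
have sum_s s : sumn (orbit_sizes s) = n.
  rewrite sumnE big_map big_enum /= -[RHS](card_ord n) -cardsT.
  apply/esym/card_partition; apply/and3P; split.
  - rewrite eqEsubset subsetT; apply/subsetP => x _; apply/bigcupP.
    by exists (porbit s x); rewrite ?imset_f ?porbit_id.
  - apply/trivIsetP => _ _ /imsetP[x _ ->] /imsetP[y _ ->] neq.
    rewrite -setI_eq0; apply: contraNT neq => /set0Pn[z /setIP[]].
    by rewrite -!eq_porbit_mem => /eqP <- /eqP <-.
  - apply/imsetP => -[x _ /setP/(_ x)]; by rewrite porbit_id inE.
have tyP s := cid (intpart_of_seq (sum_s s) (pos s)).
exists (fun s => sval (tyP s)) => s t eq_ty; apply: perm_orbit_sizes_conjg.
have := svalP (tyP t); rewrite -eq_ty (svalP (tyP s)).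
(* Orbit sizes are positive, so dropping the zeros of the padding recovers them. *)
have filt r : filter (leq 1) (sort geq (orbit_sizes r) ++ nseq (n - size (orbit_sizes r)) 0%N)
   = sort geq (orbit_sizes r).
  rewrite filter_cat filter_nseq /= cats0; apply/all_filterP.
  by rewrite all_sort.
move=> /(congr1 (filter (leq 1))); rewrite !filt => eq_sort.
by rewrite -(perm_sort geq) eq_sort perm_sort.
Qed.

End CycleType.

(** * Young symmetrizers *)

(* Cancelling the full-rank factors L and R leaves R L = c. *)
Lemma mxtrace_sq_base (F : fieldType) m r (L : 'M[F]_(m, r)) (R : 'M[F]_(r, m)) c :
    row_full L -> row_free R -> (L *m R) *m (L *m R) = c *: (L *m R) ->
  \tr (L *m R) = c *+ r.
Proof.
move=> /row_fullP[L' LL'] /row_freeP[R' RR'] sqLR.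
have RL : R *m L = c%:M.
  have -> : R *m L = L' *m ((L *m R) *m (L *m R)) *m R'.
    rewrite -[LHS]mul1mx -LL' -[LHS]mulmx1 -RR'.
    by rewrite !mulmxA.
  by rewrite sqLR -scalemxAr -scalemxAl mulmxA LL' mul1mx RR' scalemx1.
by rewrite mxtrace_mulC RL mxtrace_scalar.
Qed.

Lemma mxtrace_sq (F : fieldType) m (e : 'M[F]_m) c :
  e *m e = c *: e -> \tr e = c *+ \rank e.
Proof.
move=> sq_e; rewrite -{1}(mulmx_base e).
by apply: mxtrace_sq_base; rewrite ?col_base_full ?row_base_free ?mulmx_base.
Qed.

Section GroupAlgebra.

Variables (F : fieldType) (n : nat).
Hypothesis fact_neq0 : (n`!)%:R != 0 :> F.

Implicit Types (la mu : intpart n) (s t : 'S_n).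

Local Notation G := [set: 'S_n]%G.
Local Notation N := (gcard G).
Local Notation galg := (group_ring F G).

Definition rho (s : 'S_n) : 'M[F]_N := regular_repr F G s.

Lemma rhoM s t : rho (s * t)%g = rho s *m rho t.
Proof. by rewrite /rho repr_mxM ?inE. Qed.

Lemma rho1 : rho 1%g = 1%:M.
Proof. exact: repr_mx1. Qed.

Lemma trmx_rho s : (rho s)^T = rho s^-1%g.
Proof.
apply/matrixP => i j; rewrite !mxE /=; congr (_%:R); congr nat_of_bool.
apply/eqP/eqP => ->; rewrite gring_indexK ?inE //.
  by rewrite mulgK gring_valK.
by rewrite mulgKV gring_valK.
Qed.

Lemma gcard_neq0 : N%:R != 0 :> F.
Proof. by rewrite /gcard cardsT card_Sn. Qed.

Lemma mxtrace_rho s : \tr (rho s) = N%:R *+ (s == 1%g).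
Proof.
case: eqVneq => [->|s_neq1]; first by rewrite rho1 mxtrace1.
rewrite /mxtrace big1 // => i _; rewrite !mxE /=; case: eqP => // eq_i.
case/negP: s_neq1; apply/eqP/(mulgI (enum_val i)).
by rewrite mulg1 {2}eq_i gring_indexK ?inE.
Qed.

(** Distinct indices force [n >= 2], so that 2 divides [n!]. *)
Lemma two_neq0 (i j : 'I_n) : i != j -> 2%:R != 0 :> F.
Proof.
move=> neq_ij; have n_gt1 : (1 < n)%N.
  rewrite ltnNge; apply: contra neq_ij => le_n1; apply/eqP/val_inj.
  have lt_i := leq_trans (ltn_ord i) le_n1; have lt_j := leq_trans (ltn_ord j) le_n1.
  by move: lt_i lt_j; rewrite !ltnS !leqn0 => /eqP i0 /eqP j0; rewrite /= i0 j0.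
apply: contraNneq fact_neq0 => two0.
have /dvdnP[q ->] : (2 %| n`!)%N by apply: dvdn_fact.
by rewrite natrM two0 mulr0.
Qed.

Lemma rho_galg s : (rho s \in galg)%MS.
Proof. by apply: envelop_mx_id; rewrite inE. Qed.

Lemma galg_ind (P : 'M[F]_N -> Prop) :
    (forall a x y, P x -> P y -> P (a *: x + y)) -> P 0 -> (forall s, P (rho s)) ->
  forall x, (x \in galg)%MS -> P x.
Proof.
move=> PD P0 Prho x /envelop_mxP[c ->].
elim/big_rec: _ => [|s y _ Py]; [exact: P0 | exact: PD].
Qed.

Lemma galgM x y : (x \in galg)%MS -> (y \in galg)%MS -> (x *m y \in galg)%MS.
Proof. exact: envelop_mxM. Qed.

Lemma galgD x y : (x \in galg)%MS -> (y \in galg)%MS -> (x + y \in galg)%MS.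
Proof. by move=> Ax Ay; rewrite linearD /=; apply: addmx_sub. Qed.

Lemma galgZ a x : (x \in galg)%MS -> (a *: x \in galg)%MS.
Proof. by move=> Ax; rewrite linearZ /=; apply: scalemx_sub. Qed.

Lemma galg0 : (0 \in galg)%MS.
Proof. by rewrite linear0 sub0mx. Qed.

Lemma galg1 : (1%:M \in galg)%MS.
Proof. by rewrite -rho1 rho_galg. Qed.

Lemma galg_sum (I : Type) (r : seq I) (P : pred I) (f : I -> 'M[F]_N) :
  (forall i, P i -> (f i \in galg)%MS) -> (\sum_(i <- r | P i) f i \in galg)%MS.
Proof.
move=> Af; elim/big_rec: _ => [|i y Pi Ay]; first exact: galg0.
by apply: galgD => //; exact: Af.
Qed.

Lemma galg_tr x : (x \in galg)%MS -> (x^T \in galg)%MS.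
Proof.
move: x; apply: galg_ind => [a x y Ax Ay||s].
- by rewrite linearP /=; apply: galgD => //; exact: galgZ.
- by rewrite trmx0 galg0.
- by rewrite trmx_rho rho_galg.
Qed.

Definition sym_sum (H : {set 'S_n}) := \sum_(s in H) rho s.
Definition alt_sum (H : {set 'S_n}) := \sum_(s in H) (-1) ^+ odd_perm s *: rho s.

Lemma sym_sum_galg H : (sym_sum H \in galg)%MS.
Proof. by apply: galg_sum => s _; exact: rho_galg. Qed.

Lemma alt_sum_galg H : (alt_sum H \in galg)%MS.
Proof. by apply: galg_sum => s _; apply/galgZ/rho_galg. Qed.

Section Sums.

Variable H : {group 'S_n}.

Lemma mul_rho_sym_sum s : s \in H -> rho s *m sym_sum H = sym_sum H.
Proof.
move=> Hs; rewrite /sym_sum mulmx_sumr [RHS](reindex_inj (mulgI s)).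
by apply: eq_big => [t|t _]; rewrite ?groupMl // rhoM.
Qed.

Lemma mul_sym_sum_rho s : s \in H -> sym_sum H *m rho s = sym_sum H.
Proof.
move=> Hs; rewrite /sym_sum mulmx_suml [RHS](reindex_inj (mulIg s)).
by apply: eq_big => [t|t _]; rewrite ?groupMr // rhoM.
Qed.

Lemma mul_rho_alt_sum s : s \in H -> rho s *m alt_sum H = (-1) ^+ odd_perm s *: alt_sum H.
Proof.
move=> Hs; rewrite /alt_sum mulmx_sumr [X in _ *: X](reindex_inj (mulgI s)) scaler_sumr.
apply: eq_big => [t|t _]; first by rewrite groupMl.
by rewrite -scalemxAr rhoM scalerA odd_permM signr_addb mulrA -signr_addb addbb mul1r.
Qed.

Lemma trmx_sym_sum : (sym_sum H)^T = sym_sum H.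
Proof.
rewrite /sym_sum linear_sum /= [RHS](reindex_inj invg_inj).
by apply: eq_big => [s|s _]; rewrite ?groupV // trmx_rho.
Qed.

Lemma trmx_alt_sum : (alt_sum H)^T = alt_sum H.
Proof.
rewrite /alt_sum linear_sum /= [RHS](reindex_inj invg_inj).
by apply: eq_big => [s|s _]; rewrite ?groupV // linearZ /= trmx_rho odd_permV.
Qed.

Lemma alt_sum_sq : alt_sum H *m alt_sum H = #|H|%:R *: alt_sum H.
Proof.
rewrite {1}/alt_sum mulmx_suml.
rewrite (eq_bigr (fun _ => alt_sum H)) => [|s Hs]; last first.
  by rewrite -scalemxAl mul_rho_alt_sum // scalerA -signr_addb addbb scale1r.
by rewrite sumr_const scaler_nat.
Qed.

Lemma card_group_neq0 : #|H|%:R != 0 :> F.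
Proof.
apply: contraNneq fact_neq0 => H0.
have /dvdnP[q] : (#|H| %| #|G|)%N by apply: cardSg; exact: subsetT.
by rewrite /= cardsT card_Sn => ->; rewrite natrM H0 mulr0.
Qed.

End Sums.

Lemma sym_sum_sub (H K : {group 'S_n}) : H \subset K ->
  sym_sum H *m sym_sum K = #|H|%:R *: sym_sum K.
Proof.
move=> /subsetP sHK; rewrite {1}/sym_sum mulmx_suml.
rewrite (eq_bigr (fun _ => sym_sum K)) => [|s /sHK]; last exact: mul_rho_sym_sum.
by rewrite sumr_const scaler_nat.
Qed.

(** The transposition is absorbed by [sym_sum H] without change; carried past [rho x], it is
    absorbed by [alt_sum K] with sign -1. So the product is its own opposite, and 2 is
    invertible. *)
Lemma sym_alt_kill (H K : {group 'S_n}) (x : 'S_n) (i j : 'I_n) : i != j ->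
    tperm i j \in H -> tperm (x i) (x j) \in K ->
  sym_sum H *m rho x *m alt_sum K = 0.
Proof.
move=> neq_ij Hij Kij; set X := _ *m _.
have X_opp : X = - X.
  rewrite {1}/X -{1}(mul_sym_sum_rho Hij) -!mulmxA [rho _ *m (rho x *m _)]mulmxA.
  rewrite -rhoM conjgC tpermJ rhoM -!mulmxA mul_rho_alt_sum //.
  by rewrite odd_tperm (inj_eq perm_inj) neq_ij scaleN1r !mulmxN mulmxA.
apply/eqP; have /eqP : 2%:R *: X = 0 by rewrite scaler_nat mulr2n {1}X_opp addNr.
by rewrite scaler_eq0 (negPf (two_neq0 neq_ij)).
Qed.

Lemma row_stab_group la : group_set (row_stab la).
Proof.
apply/group_setP; split=> [|s t]; rewrite !inE.
  by apply/forallP => i; rewrite perm1.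
move=> /forallP Rs /forallP Rt; apply/forallP => i.
by rewrite permM (eqP (Rt _)) Rs.
Qed.
Canonical row_group la := Group (row_stab_group la).

Lemma col_stab_group la : group_set (col_stab la).
Proof.
apply/group_setP; split=> [|s t]; rewrite !inE.
  by apply/forallP => i; rewrite perm1.
move=> /forallP Rs /forallP Rt; apply/forallP => i.
by rewrite permM (eqP (Rt _)) Rs.
Qed.
Canonical col_group la := Group (col_stab_group la).

Lemma tperm_row_stab la (i j : 'I_n) :
  cell_row la i = cell_row la j -> tperm i j \in row_stab la.
Proof.
rewrite inE /cell_row => eq_ij; apply/forallP => k.
by case: tpermP => [->|->|_ _]; rewrite ?eq_ij.
Qed.

Lemma tperm_col_stab la (i j : 'I_n) :
  cell_col la i = cell_col la j -> tperm i j \in col_stab la.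
Proof.
rewrite inE /cell_col => eq_ij; apply/forallP => k.
by case: tpermP => [->|->|_ _]; rewrite ?eq_ij.
Qed.

Definition row_sym la := sym_sum (row_stab la).
Definition col_alt la := alt_sum (col_stab la).
Definition young la := row_sym la *m col_alt la.

Lemma row_sym_galg la : (row_sym la \in galg)%MS. Proof. exact: sym_sum_galg. Qed.
Lemma col_alt_galg la : (col_alt la \in galg)%MS. Proof. exact: alt_sum_galg. Qed.
Lemma young_galg la : (young la \in galg)%MS.
Proof. by apply: galgM; [exact: row_sym_galg | exact: col_alt_galg]. Qed.

Lemma trmx_young la : (young la)^T = col_alt la *m row_sym la.
Proof. by rewrite trmx_mul trmx_alt_sum trmx_sym_sum. Qed.

Lemma row_rho_col_kill la mu g : ~ collision_free la mu g ->
  row_sym la *m rho g *m col_alt mu = 0.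
Proof.
move=> /collision[i [j [neq_ij rij cij]]]; apply: (sym_alt_kill neq_ij).
  exact: tperm_row_stab.
exact: tperm_col_stab.
Qed.

Lemma row_col_kill la mu : (forall g, ~ collision_free la mu g) ->
  forall x, (x \in galg)%MS -> row_sym la *m x *m col_alt mu = 0.
Proof.
move=> coll; apply: galg_ind => [a x y x0 y0||g].
- by rewrite mulmxDr mulmxDl -scalemxAr -scalemxAl x0 y0 scaler0 addr0.
- by rewrite mulmx0 mul0mx.
- exact: row_rho_col_kill.
Qed.

Lemma col_row_kill la mu : (forall g, ~ collision_free la mu g) ->
  forall x, (x \in galg)%MS -> col_alt mu *m x *m row_sym la = 0.
Proof.
move=> coll x Ax; apply: (can_inj trmxK); rewrite !trmx_mul trmx0 trmx_sym_sum trmx_alt_sum.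
by rewrite mulmxA row_col_kill // galg_tr.
Qed.

(** On a group element [g], a collision gives 0; otherwise [g = s t] by von Neumann's lemma,
    [row_sym] absorbs [s], and [col_alt] absorbs [t] up to sign. *)
Lemma row_col_scalar la x : (x \in galg)%MS ->
  exists c, row_sym la *m x *m col_alt la = c *: young la.
Proof.
move: x; apply: galg_ind => [a x y [c Ec] [d Ed]||g].
- exists (a * c + d); rewrite mulmxDr mulmxDl -scalemxAr -scalemxAl Ec Ed.
  by rewrite scalerA -scalerDl.
- by exists 0; rewrite mulmx0 mul0mx scale0r.
have [free_g|coll_g] := pselect (collision_free la la g); last first.
  by exists 0; rewrite row_rho_col_kill // scale0r.
have [s [t [Rs Ct ->]]] := collision_free_split free_g.
exists ((-1) ^+ odd_perm t); rewrite rhoM mulmxA mul_sym_sum_rho // -mulmxA.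
by rewrite mul_rho_alt_sum // -scalemxAr.
Qed.

Lemma young_scalar la x : (x \in galg)%MS ->
  exists c, young la *m x *m young la = c *: young la.
Proof.
move=> Ax; have [] := @row_col_scalar la (col_alt la *m x *m row_sym la).
  by rewrite !galgM ?col_alt_galg ?row_sym_galg.
by move=> c Ec; exists c; rewrite -Ec /young !mulmxA.
Qed.

(** By dominance, either the outer pair [row_sym la], [col_alt mu] or the inner pair [col_alt la],
    [row_sym mu] annihilates whatever stands between its members. *)
Lemma young_neq la mu x : la <> mu -> (x \in galg)%MS ->
  young la *m x *m young mu = 0.
Proof.
move=> /collision_neq[coll|coll] Ax.
  have -> : young la *m x *m young mu
    = row_sym la *m (col_alt la *m x *m row_sym mu) *m col_alt mu.
    by rewrite /young !mulmxA.
  by rewrite row_col_kill // !galgM ?col_alt_galg ?row_sym_galg.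
have -> : young la *m x *m young mu
  = row_sym la *m (col_alt la *m x *m row_sym mu) *m col_alt mu.
  by rewrite /young !mulmxA.
by rewrite col_row_kill // mulmx0 mul0mx.
Qed.

(** The transpose exchanges the two factors for [mu], so the annihilating pair is now [col_alt mu],
    [row_sym la] or [row_sym mu], [col_alt la]. *)
Lemma tr_young_neq la mu x : la <> mu -> (x \in galg)%MS ->
  (young mu)^T *m x *m young la = 0.
Proof.
rewrite trmx_young => /collision_neq[coll|coll] Ax.
  have -> : col_alt mu *m row_sym mu *m x *m young la
    = (col_alt mu *m (row_sym mu *m x) *m row_sym la) *m col_alt la.
    by rewrite /young !mulmxA.
  by rewrite col_row_kill ?mul0mx // galgM ?row_sym_galg.
have -> : col_alt mu *m row_sym mu *m x *m young la
  = col_alt mu *m (row_sym mu *m (x *m row_sym la) *m col_alt la).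
  by rewrite /young !mulmxA.
by rewrite row_col_kill ?mulmx0 // galgM ?row_sym_galg.
Qed.

Lemma row_col_stab1 la s : s \in row_stab la -> s \in col_stab la -> s = 1%g.
Proof.
rewrite !inE => /forallP Rs /forallP Cs; apply/permP => i; rewrite perm1.
by apply: (@cell_inj n la); apply/eqP; [exact: Rs | exact: Cs].
Qed.

(** Only the identity has nonzero trace in the regular representation, and a row permutation times a
    column permutation is the identity only if both are. *)
Lemma mxtrace_young la : \tr (young la) = N%:R.
Proof.
have tr_st s t : s \in row_stab la -> t \in col_stab la ->
    \tr (rho s *m rho t) = N%:R *+ ((s == 1%g) && (t == 1%g)).
  move=> Rs Ct; rewrite -rhoM mxtrace_rho; congr (_ *+ nat_of_bool _).
  apply/idP/andP => [|[/eqP-> /eqP->]]; last by rewrite mulg1.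
  rewrite -eq_invg_mul => /eqP def_t.
  have s1 : s = 1%g.
    by apply: (@row_col_stab1 la) => //; rewrite -(groupV (col_group la)) def_t.
  by rewrite -def_t s1 invg1.
rewrite /young /row_sym /col_alt /sym_sum /alt_sum mulmx_suml linear_sum /=.
rewrite (bigD1 1%g) ?(group1 (row_group la)) //= mulmx_sumr linear_sum /=.
rewrite (bigD1 1%g) ?(group1 (col_group la)) //= odd_perm1 scale1r.
rewrite tr_st ?(group1 (row_group la)) ?(group1 (col_group la)) // !eqxx.
rewrite big1 => [|t /andP[Ct t1]].
  rewrite big1 ?addr0 // => s /andP[Rs s1]; rewrite mulmx_sumr linear_sum big1 //= => t Ct.
  by rewrite -scalemxAr linearZ /= tr_st // (negPf s1) mulr0.
by rewrite -scalemxAr linearZ /= tr_st ?(group1 (row_group la)) // (negPf t1) andbF mulr0.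
Qed.

(** The trace of [young la] is [n!], and also [c] times its rank by [mxtrace_sq]; hence [c] is not
    zero. *)
Lemma young_sq la : exists2 c : F, c != 0 & young la *m young la = c *: young la.
Proof.
have [] := @young_scalar la 1%:M galg1; rewrite mulmx1 => c Ec; exists c => //.
have := mxtrace_young la; rewrite (mxtrace_sq Ec) => tr_c.
by apply: contraNneq gcard_neq0 => c0; rewrite -tr_c c0 mul0rn.
Qed.

Lemma young_neq0 la : young la != 0.
Proof.
by apply: contraNneq gcard_neq0 => e0; rewrite -(mxtrace_young la) e0 mxtrace0.
Qed.

(** On the group algebra this is [n!] times the coefficient of [rho s], by orthogonality of the
    [rho s] under the trace form. *)
Definition rho_coef (x : 'M[F]_N) s := \tr (x *m (rho s)^T).

Lemma rho_coef_rho s t : rho_coef (rho s) t = N%:R *+ (s == t).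
Proof. by rewrite /rho_coef trmx_rho -rhoM mxtrace_rho -eq_mulgV1. Qed.

Lemma rho_coefP a x y s : rho_coef (a *: x + y) s = a * rho_coef x s + rho_coef y s.
Proof. by rewrite /rho_coef mulmxDl -scalemxAl linearP. Qed.

Lemma galg_expand x : (x \in galg)%MS -> N%:R *: x = \sum_s rho_coef x s *: rho s.
Proof.
move: x; apply: galg_ind => [a x y Ex Ey||s].
- rewrite scalerDr scalerA mulrC -scalerA Ex Ey scaler_sumr -big_split; apply: eq_bigr => s _.
  by rewrite rho_coefP scalerDl scalerA.
- by rewrite scaler0 big1 // => s _; rewrite /rho_coef mul0mx mxtrace0 scale0r.
- rewrite (bigD1 s) //= rho_coef_rho eqxx big1 ?addr0 // => t.
  by rewrite rho_coef_rho eq_sym => /negPf ->; rewrite scale0r.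
Qed.

Lemma rho_coef_eq0 x : (x \in galg)%MS -> (forall s, rho_coef x s = 0) -> x = 0.
Proof.
move=> /galg_expand Ex x0; apply/eqP; rewrite -(inj_eq (scalerI gcard_neq0)) scaler0.
by rewrite Ex big1 // => s _; rewrite x0 scale0r.
Qed.

(** On the group algebra, [n!] times the averaging projection onto the centre. *)
Definition class_sum x := \sum_s (rho s)^T *m x *m rho s.

Lemma class_sum_galg x : (x \in galg)%MS -> (class_sum x \in galg)%MS.
Proof.
by move=> Ax; apply: galg_sum => s _; rewrite !galgM ?galg_tr ?rho_galg.
Qed.

Lemma rho_coef_class_sum x s u : rho_coef (class_sum x) (s ^ u)%g = rho_coef (class_sum x) s.
Proof.
rewrite /rho_coef /conjg !rhoM !trmx_mul !trmx_rho invgK !mulmxA mxtrace_mulC !mulmxA.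
congr (\tr (_ *m _)); rewrite /class_sum mulmx_sumr mulmx_suml.
rewrite [RHS](reindex_inj (mulIg u^-1%g)); apply: eq_bigr => t _.
by rewrite !trmx_rho invMg invgK !rhoM !mulmxA.
Qed.

(** Each [e rho(g) e] is a multiple of [e], and taking traces finds the factor. Summing over [g]
    with [galg_expand] gives the value [c^2 n!], where [e e = c e]. *)
Lemma mxtrace_class_sum_young la (e := young la) : \tr (class_sum e *m e) != 0.
Proof.
have [c c_neq0 sq_e] := young_sq la; rewrite -/e in sq_e.
have Ae : (e \in galg)%MS by exact: young_galg.
have tr_e : \tr e = N%:R := mxtrace_young la.
have Eg g : \tr ((rho g)^T *m e *m rho g *m e) = c / N%:R * (\tr (e *m rho g) * rho_coef e g).
  have [d Ed] := young_scalar la (rho_galg g); rewrite -/e in Ed.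
  have -> : (rho g)^T *m e *m rho g *m e = d *: ((rho g)^T *m e).
    by rewrite scalemxAr -Ed !mulmxA.
  rewrite linearZ /= mxtrace_mulC -/(rho_coef e g) mulrA; congr (_ * _).
  have := congr1 mxtrace Ed; rewrite linearZ /= tr_e mxtrace_mulC mulmxA sq_e.
  rewrite -scalemxAl linearZ /= => Ec.
  by rewrite mulrAC Ec mulfK ?gcard_neq0.
rewrite /class_sum mulmx_suml linear_sum /= (eq_bigr _ (fun g _ => Eg g)) -mulr_sumr.
have -> : \sum_g \tr (e *m rho g) * rho_coef e g = N%:R * (c * N%:R).
  transitivity (\tr (e *m (N%:R *: e))); last by rewrite -scalemxAr sq_e !linearZ /= tr_e.
  rewrite galg_expand // mulmx_sumr linear_sum; apply: eq_bigr => g _ /=.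
  by rewrite -scalemxAr linearZ /= mulrC.
by rewrite !mulf_neq0 ?invr_neq0 ?gcard_neq0.
Qed.

Lemma exists_null_row m p (K : 'M[F]_(m, p)) : ~~ row_free K ->
  exists2 w : 'rV_m, w != 0 & w *m K = 0.
Proof.
rewrite -kermx_eq0 => /rowV0Pn[w /sub_kermxP wK w0]; by exists w.
Qed.

(* The class sums of the Young symmetrizers are linearly independent class
   functions, as many as there are cycle types; an element annihilating all
   Young symmetrizers would provide one more. *)
Lemma galg_annihilator0 (i0 : 'I_n) y : (y \in galg)%MS ->
  (forall la s, y *m rho s *m young la = 0) -> y = 0.
Proof.
move=> Ay ye0; apply: rho_coef_eq0 => // u; apply/eqP/negPn/negP => yu_neq0.
(* The translation moves the nonzero coefficient of [u] to the identity, which conjugation fixes. *)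
pose z := class_sum (y *m (rho u)^T).
have Az : (z \in galg)%MS by rewrite class_sum_galg ?galgM ?galg_tr ?rho_galg.
have tr_z : \tr z != 0.
  rewrite /z /class_sum linear_sum /=.
  rewrite (eq_bigr (fun _ => rho_coef y u)) => [|g _]; last first.
    by rewrite mxtrace_mulC [rho g *m _]mulmxA (trmx_rho g) -rhoM mulgV rho1 mul1mx.
  by rewrite sumr_const card_Sn -mulr_natl mulf_neq0.
have ze la : z *m young la = 0.
  rewrite mulmx_suml big1 // => g _; rewrite !trmx_rho -!mulmxA [rho u^-1%g *m _]mulmxA.
  by rewrite -rhoM [y *m _]mulmxA ye0 mulmx0.
have [ty ty_conj] := cycle_type_exists i0.
(* [None] stands for the additional class function, so that [K] below has one more row than
   columns. *)
pose Z o := if o is Some la then class_sum (young la) else z.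
have AZ o : (Z o \in galg)%MS by case: o => [la|] //=; rewrite class_sum_galg ?young_galg.
pose repr_ty la := odflt 1%g [pick s | ty s == la].
have Zcoef o s : rho_coef (Z o) s = rho_coef (Z o) (repr_ty (ty s)).
  rewrite /repr_ty; case: pickP => [t /= /eqP/ty_conj[v ->]|/(_ s)]; last by rewrite eqxx.
  by case: o => [la|]; rewrite /= rho_coef_class_sum.
pose K : 'M[F]_(#|{: option (intpart n)}|, #|{: intpart n}|) :=
  \matrix_(i, j) rho_coef (Z (enum_val i)) (repr_ty (enum_val j)).
have [|w w_neq0 wK] := @exists_null_row _ _ K.
  rewrite /row_free neq_ltn; apply/orP; left.
  by apply: leq_ltn_trans (rank_leq_col K) _; rewrite card_option.
pose a o := w 0 (enum_rank o).
have aZ : \sum_o a o *: Z o = 0.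
  apply: rho_coef_eq0 => [|s]; first by apply: galg_sum => o _; exact: galgZ.
  rewrite /rho_coef mulmx_suml linear_sum /=.
  have /matrixP/(_ 0 (enum_rank (ty s))) := wK; rewrite !mxE => wKs.
  rewrite -[RHS]wKs (reindex (fun i : 'I_#|{: option (intpart n)}| => enum_val i)) /=; last first.
    by apply: onW_bij; exact: enum_val_bij.
  apply: eq_bigr => i _; rewrite /a enum_valK mxE enum_rankK -Zcoef.
  by rewrite -scalemxAl linearZ.
(* Multiplying by [young mu] and taking the trace leaves only the term of [mu], by orthogonality and
   [ze]. *)
have a_Some mu : a (Some mu) = 0.
  have /eqP := congr1 (fun X => \tr (X *m young mu)) aZ; rewrite /= mul0mx mxtrace0.
  rewrite mulmx_suml (bigD1 (Some mu)) //= big1 => [|[la|] neq_o].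
  - rewrite addr0 -scalemxAl linearZ /= mulf_eq0 (negPf (mxtrace_class_sum_young mu)) orbF.
    by move/eqP.
  - rewrite -scalemxAl /= /class_sum mulmx_suml big1 ?scaler0 // => g _.
    rewrite -(mulmxA (rho g)^T) -(mulmxA (rho g)^T) young_neq ?mulmx0 ?rho_galg // => eq_la.
    by rewrite eq_la eqxx in neq_o.
  - by rewrite -scalemxAl /= ze scaler0.
have a_None : a None = 0.
  have /eqP := congr1 mxtrace aZ; rewrite mxtrace0 (bigD1 None) //= big1 => [|[la|] //].
    by rewrite addr0 linearZ /= mulf_eq0 (negPf tr_z) orbF => /eqP.
  by rewrite a_Some scale0r.
case/negP: w_neq0; apply/eqP/rowP => i; rewrite mxE -[i]enum_valK.
by case: (enum_val i) => [la|]; [exact: a_Some | exact: a_None].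
Qed.

(** The two-sided ideals of the Young symmetrizers span the group algebra. Otherwise a nonzero
    functional vanishes on all [gen j]; the trace form represents it by some [y] with
    [y rho(s) young la = 0] for all [s] and [la], and [galg_annihilator0] gives [y = 0]. *)
Lemma young_ind (i0 : 'I_n) (P : 'M[F]_N -> Prop) :
    (forall a x y, P x -> P y -> P (a *: x + y)) -> P 0 ->
    (forall la s t, P (rho s *m young la *m rho t)) ->
  forall x, (x \in galg)%MS -> P x.
Proof.
move=> PD P0 Pe; apply: galg_ind => // u.
pose J := (intpart n * 'S_n * 'S_n)%type.
pose gen (j : J) := rho j.1.2 *m young j.1.1 *m rho j.2.
have Agen j : (gen j \in galg)%MS.
  by apply: galgM (rho_galg _); apply: galgM (rho_galg _) (young_galg _).
pose K : 'M[F]_(#|{: J}|, #|{: 'S_n}|) :=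
  \matrix_(i, v) rho_coef (gen (enum_val i)) (enum_val v).
have [/row_fullP[B BK]|not_full] := boolP (row_full K).
  pose c i := B (enum_rank u) i.
  pose x := \sum_i c i *: gen (enum_val i).
  have Px : P x.
    rewrite /x; elim/big_rec: _ => [|i y _ Py]; first exact: P0.
    by apply: PD Py; exact: Pe.
  have Ax : (x \in galg)%MS by apply: galg_sum => i _; exact/galgZ/Agen.
  (* [rho_coef] carries a factor [n!], so [x] is [rho u] divided by it. *)
  have -> : rho u = N%:R *: x + 0; last exact: PD.
  rewrite addr0 galg_expand //.
  have x_coef v : rho_coef x v = (u == v)%:R.
    have /matrixP/(_ (enum_rank u) (enum_rank v)) := BK.
    rewrite !mxE (inj_eq enum_rank_inj) => <-; rewrite /rho_coef mulmx_suml linear_sum /=.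
    by apply: eq_bigr => i _; rewrite !mxE enum_rankK -scalemxAl linearZ.
  rewrite (bigD1 u) //= x_coef eqxx scale1r big1 ?addr0 // => v.
  by rewrite x_coef eq_sym => /negPf ->; rewrite scale0r.
have [|w w_neq0 wK] := @exists_null_row _ _ K^T; first by rewrite /row_free mxrank_tr.
pose y := \sum_v w 0 (enum_rank v) *: (rho v)^T.
have Ay : (y \in galg)%MS by apply: galg_sum => v _; rewrite galgZ ?galg_tr ?rho_galg.
have tr_gen j : \tr (gen j *m y) = 0.
  have /matrixP/(_ 0 (enum_rank j)) := wK; rewrite !mxE => wKj; rewrite -[RHS]wKj.
  rewrite mulmx_sumr linear_sum (reindex (fun i : 'I_#|{: 'S_n}| => enum_val i)) /=; last first.
    by apply: onW_bij; exact: enum_val_bij.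
  by apply: eq_bigr => i _; rewrite !mxE enum_rankK enum_valK -scalemxAr linearZ.
case/negP: w_neq0; apply/eqP/rowP => i; rewrite mxE.
have y0 : y = 0.
  apply: (galg_annihilator0 i0) => // la s; apply: rho_coef_eq0 => [|t].
    by apply: galgM (young_galg _); apply: galgM (rho_galg _).
  rewrite /rho_coef -!mulmxA mxtrace_mulC trmx_rho.
  by have := tr_gen (la, s, t^-1%g); rewrite /gen /= !mulmxA.
have := congr1 (fun X => \tr (X *m rho (enum_val i))) y0.
rewrite /= mul0mx mxtrace0 mulmx_suml linear_sum /= (bigD1 (enum_val i)) //= big1 => [|v neq_v].
  rewrite addr0 -scalemxAl linearZ /= trmx_rho -rhoM mulVg rho1 mxtrace1 enum_valK => /eqP.
  by rewrite mulf_eq0 (negPf gcard_neq0) orbF => /eqP.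
rewrite -scalemxAl linearZ /= trmx_rho -rhoM mxtrace_rho -eq_mulVg1 (negPf neq_v).
by rewrite mulr0.
Qed.
End GroupAlgebra.

(** * Sums of rook monomials *)

Section RookRelations.

Variables (R : comNzRingType) (n : nat).
Implicit Types (D I Z : {set 'I_n}) (g s : 'S_n) (y : 'I_n -> 'I_n -> R).

(** By induction on [I]: the permutation found for the other points is corrected at [x] by a
    transposition that does not disturb their images. *)
Lemma perm_extension g (f : 'I_n -> 'I_n) I Z :
    {in I &, injective f} -> {in I, forall i, f i \in Z} -> {in I, forall i, g i \in Z} ->
  exists2 s, perm_on Z s & {in I, forall i, s (g i) = f i}.
Proof.
elim: {I}_.+1 {-2}I (ltnSn #|I|) => // m IHm I le_m f_inj fZ gZ.
have [->|[x Ix]] := set_0Vmem I.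
  by exists 1%g; [exact: perm_on1 | move=> i; rewrite inE].
have sub i : i \in I :\ x -> i \in I by case/setD1P.
have [||||s Zs sE] := IHm (I :\ x).
- by move: le_m; rewrite (cardsD1 x) Ix.
- by move=> i j /sub Ii /sub Ij; exact: f_inj.
- by move=> i /sub; exact: fZ.
- by move=> i /sub; exact: gZ.
exists (s * tperm (s (g x)) (f x))%g => [|i Ii].
  apply: perm_onM => //; apply/subsetP => i; rewrite inE.
  by case: tpermP => [-> _|-> _|]; rewrite ?eqxx // ?fZ // perm_closed ?gZ.
rewrite permM; have [->|neq_ix] := eqVneq i x; first by rewrite tpermL.
have Ii' : i \in I :\ x by rewrite !inE neq_ix.
rewrite tpermD; first exact: sE.
  by rewrite !(inj_eq perm_inj) eq_sym.
by rewrite sE // (inj_in_eq f_inj) // eq_sym.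
Qed.

(** The relations of the quotient ring, for an array in any commutative ring. Column sums are
    covered by imposing the same conditions on the transposed array. *)
Definition rook_relations y :=
  [/\ forall i j j', y i j * y i j' = 0, forall i i' j, y i j * y i' j = 0
    & forall i, \sum_j y i j = 0].

Section Symmetrize.

Variable y : 'I_n -> 'I_n -> R.
Hypothesis yP : rook_relations y.

Lemma prod_noninj D (f : 'I_n -> 'I_n) :
  ~ {in D &, injective f} -> \prod_(i in D) y i (f i) = 0.
Proof.
move=> /existsNP[i /existsNP[j]].
move=> /not_implyP[Di /not_implyP[Dj /not_implyP[eq_f /eqP neq_ij]]].
rewrite (bigD1 i) //= (bigD1 j) /=; last by rewrite Dj eq_sym.
by case: yP => _ col0 _; rewrite eq_f mulrA col0 mul0r.
Qed.

(** Expanding the product of sums yields choice functions [f]. Non-injective ones contribute 0; an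
    injective one is [s] after [g] on [I] for exactly one coset of the permutations of [Z] that fix
    [g @: I] pointwise, whence the factorial. *)
Lemma sum_perm_on_prod g I Z (C : 'I_n -> {set 'I_n}) :
    {in I, forall i, g i \in Z} -> {in I, forall i, C i \subset Z} ->
  \sum_(s | perm_on Z s && [forall i in I, s (g i) \in C i]) \prod_(i in I) y i (s (g i))
  = (#|Z| - #|I|)`!%:R * \prod_(i in I) \sum_(c in C i) y i c.
Proof.
move=> gZ CZ.
have [I0|[j0 _]] := set_0Vmem I.
  rewrite I0 cards0 subn0 big_set0 mulr1 -card_perm -sum1_card natr_sum.
  apply: eq_big => [s|s _]; last by rewrite big_set0.
  rewrite [RHS]unfold_in; apply: andb_idr => _; apply/forall_inP => i; by rewrite inE.
rewrite (big_distr_big_dep j0) /=.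
(* The constant [j0] off [I] is what membership in [pfamily] requires. *)
pose p s := [ffun i => if i \in I then s (g i) else j0].
rewrite mulr_sumr.
rewrite (partition_big p (fun f => f \in pfamily j0 (mem I) (fun i => mem (C i)))) /=; last first.
  move=> s /andP[_ /forall_inP sC]; apply/pfamilyP; split=> [|i Ii]; last first.
    by rewrite ffunE Ii; apply: sC.
  by apply/supportP => i nIi; rewrite ffunE (negPf nIi).
apply: eq_bigr => f /pfamilyP[/supportP f_out fC].
have p_f s : p s == f -> {in I, forall i, s (g i) = f i}.
  by move=> /eqP <- i Ii; rewrite ffunE Ii.
rewrite (eq_bigr (fun _ => \prod_(i in I) y i (f i))); last first.
  by move=> s /andP[_ /p_f eq_s]; apply: eq_bigr => i Ii; rewrite eq_s.
have [f_inj|f_ninj] := pselect ({in I &, injective f}); last first.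
  by rewrite prod_noninj // mulr0 big1.
have fZ : {in I, forall i, f i \in Z} by move=> i Ii; apply: subsetP (CZ i Ii) _ (fC i Ii).
have [s0 Zs0 s0E] := perm_extension f_inj fZ gZ.
rewrite sumr_const mulr_natl; congr (_ *+ _).
rewrite -[#|I|](card_imset _ (@perm_inj _ g)).
have sub_gI : g @: I \subset Z by apply/subsetP => _ /imsetP[i Ii ->]; exact: gZ.
rewrite -{1}(setIidPr sub_gI) -cardsD -card_perm -[RHS](card_imset _ (mulIg s0)).
apply: eq_card => s; apply/idP/imsetP => [|[t Zt ->]]; rewrite unfold_in.
  move=> /andP[/andP[Zs _] /p_f sE]; exists (s * s0^-1)%g; last by rewrite mulgKV.
  apply/subsetP => j; rewrite !inE; apply: contraR; rewrite negb_and negbK permM.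
  case/orP => [/imsetP[i Ii ->]|nZj]; first by rewrite sE // -s0E // permK.
  by rewrite (out_perm Zs nZj); apply/eqP/(canLR (permK s0)); rewrite (out_perm Zs0 nZj).
have tsE : {in I, forall i, (t * s0)%g (g i) = f i}.
  move=> i Ii; rewrite permM (out_perm Zt) ?s0E //.
  by rewrite !inE negb_and negbK imset_f.
apply/andP; split; last first.
  by apply/eqP/ffunP => i; rewrite ffunE; case: ifP => [/tsE //|/negbT/f_out].
apply/andP; split; last by apply/forall_inP => i Ii; rewrite tsE //; exact: fC.
apply: perm_onM => //; apply: subset_trans Zt _; exact: subsetDl.
Qed.

(** The case [I = Z = D], [g = 1], where the factorial is [0! = 1]. *)
Lemma prod_sum_perm_on D (C : 'I_n -> {set 'I_n}) : {in D, forall i, C i \subset D} ->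
  \prod_(i in D) \sum_(c in C i) y i c
  = \sum_(s | perm_on D s && [forall i in D, s i \in C i]) \prod_(i in D) y i (s i).
Proof.
move=> CD; have := @sum_perm_on_prod 1%g D D C; rewrite subnn fact0 mul1r => <- //.
  apply: eq_big => [s|s _].
    by congr (_ && _); apply: eq_forallb => i; rewrite perm1.
  by apply: eq_bigr => i _; rewrite perm1.
by move=> i; rewrite perm1.
Qed.

Definition complement_choice g Z i := if g i \in Z then ~: Z else [set g i].

(* Symmetrizing over Z replaces each factor whose column lies in Z by the sum
   over Z, which is minus the sum over the complement of Z. *)
Lemma sum_perm_on g D Z (p := #|[set i in D | g i \in Z]|) :
  \sum_(s | perm_on Z s) \prod_(i in D) y i (s (g i))
  = (#|Z| - p)`!%:R * (-1) ^+ p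
    * \prod_(i in D) \sum_(c in complement_choice g Z i) y i c.
Proof.
set I := [set i in D | g i \in Z] in p *.
have split_prod (f : 'I_n -> R) :
    \prod_(i in D) f i = \prod_(i in I) f i * \prod_(i in D :\: I) f i.
  have sID : I \subset D by apply/subsetP => i; rewrite inE => /andP[].
  by rewrite (big_setID I) /= (setIidPr sID).
have gI i : i \in D :\: I -> g i \notin Z.
  by rewrite !inE => /andP[+ Di]; rewrite Di.
rewrite (eq_bigr (fun s => \prod_(i in I) y i (s (g i)) * \prod_(i in D :\: I) y i (g i))); last first.
  move=> s Zs; rewrite split_prod; congr (_ * _); apply: eq_bigr => i /gI nZ.
  by rewrite (out_perm Zs nZ).
rewrite -mulr_suml split_prod mulrA; congr (_ * _); last first.
  by apply: eq_bigr => i /gI nZ; rewrite /complement_choice (negPf nZ) big_set1.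
have gZ : {in I, forall i, g i \in Z} by move=> i; rewrite inE => /andP[].
have := @sum_perm_on_prod g I Z (fun=> Z) gZ (fun _ _ => subxx _).
rewrite (eq_bigl (perm_on Z)) => [->|s]; last first.
  by apply: andb_idr => Zs; apply/forall_inP => i /gZ gZi; rewrite (perm_closed _ Zs).
rewrite -mulrA -prodrN; congr (_ * _); apply: eq_bigr => i /gZ gZi.
rewrite /complement_choice gZi; apply/eqP; rewrite -addr_eq0; apply/eqP.
have rs : \sum_j y i j = 0 by case: yP.
rewrite -[RHS]rs [RHS](bigID (mem Z)) /=; congr (_ + _).
by apply: eq_bigl => c; rewrite inE.
Qed.

(** After [sum_perm_on], all chosen columns lie in the complement of [Z], which is too small for an
    injective choice on [D]. *)
Lemma sum_perm_on_eq0 g D Z : (#|~: Z| < #|D|)%N ->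
  \sum_(s | perm_on Z s) \prod_(i in D) y i (s (g i)) = 0.
Proof.
move=> lt_ZD; rewrite sum_perm_on.
have [D0|[j0 _]] := set_0Vmem D; first by rewrite D0 cards0 in lt_ZD.
rewrite (big_distr_big_dep j0) /= big1 ?mulr0 // => f /pfamilyP[_ fC].
apply: prod_noninj => f_inj; move: lt_ZD; rewrite ltnNge => /negP; apply.
rewrite -(card_in_imset f_inj); apply/subset_leq_card/subsetP => _ /imsetP[i Di ->].
have := fC i Di; rewrite /complement_choice; case: ifP => [_ //|nZ].
by rewrite !inE => /eqP ->; rewrite nZ.
Qed.

End Symmetrize.

(** By [sum_perm_on], both sides are the same constant times a sum over the permutations of [D] that
    agree with [g], respectively with its inverse, wherever these stay inside [D]. Inversion
    exchanges the two sums. *)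
Lemma sum_perm_on_transpose y g D :
    rook_relations y -> rook_relations (fun i j => y j i) ->
  \sum_(s | perm_on (~: D) s) \prod_(i in D) y i (s (g i))
  = \sum_(s | perm_on (~: D) s) \prod_(j in D) y (s (g^-1%g j)) j.
Proof.
move=> yP yTP; rewrite (sum_perm_on yP) (@sum_perm_on _ yTP g^-1%g D).
(* [g] and its inverse leave [D] equally often, so signs and factorials agree. *)
have -> : #|[set i in D | g i \in ~: D]| = #|[set j in D | g^-1%g j \in ~: D]|.
  have card_in h : #|[set i in D | h i \in ~: D]| = (#|D| - #|[set i in D | h i \in D]|)%N.
    rewrite -[X in (X - _)%N](cardsID [set i | h i \in D] D) addnC.
    rewrite (_ : D :&: [set i | _] = [set i in D | h i \in D]) ?addnK; last first.
      by apply/setP=> i; rewrite !inE.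
    by apply: eq_card => i; rewrite !inE andbC.
  rewrite !card_in -(card_imset [set i in D | g i \in D] (@perm_inj _ g)); congr (_ - _)%N.
  apply: eq_card => j; apply/imsetP/idP => [[i + ->]|].
    by rewrite !inE permK andbC.
  by rewrite inE => /andP[Dj Dgj]; exists (g^-1%g j); rewrite ?inE permKV ?Dgj.
congr (_ * _).
have cD h : {in D, forall i, complement_choice h (~: D) i \subset D}.
  move=> i Di; rewrite /complement_choice setCK; case: ifPn => // nD.
  by rewrite sub1set; rewrite inE negbK in nD.
rewrite (prod_sum_perm_on yP (cD g)) (prod_sum_perm_on yTP (cD g^-1%g)).
rewrite [RHS](reindex_inj invg_inj) /=; apply: eq_big => [s|s /andP[Ds _]].
  have -> : perm_on D s^-1%g = perm_on D s.
    by apply/idP/idP => /perm_onV; rewrite ?invgK.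
  case: (boolP (perm_on D s)) => //= Ds.
  apply/forall_inP/forall_inP => sC i Di; rewrite /complement_choice !inE setCK.
    case: ifPn => [_|]; first by rewrite (perm_closed _ (perm_onV Ds)).
    rewrite negbK => Dgi; have := sC _ Dgi.
    rewrite /complement_choice permKV inE Di /= inE => /eqP E.
    by rewrite inE; apply/eqP/(canLR (permK s)).
  case: ifPn => [_|]; first by rewrite perm_closed.
  rewrite negbK => Dgi; have := sC _ Dgi.
  rewrite /complement_choice inE permK Di /= inE => /eqP E.
  by rewrite inE; apply/eqP/(canLR (permKV s)).
rewrite [RHS](reindex_inj (@perm_inj _ s)) /=.
by apply: eq_big => [i|i _]; rewrite ?perm_closed ?permK.
Qed.

End RookRelations.

(** * Spanning of the quotient by rook monomials *)

Section Monomials.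

Variables (F : fieldType) (n : nat).

Lemma mxpi_ideal0 (p : mxpol F n) : mxgen p -> mxpi p = 0.
Proof.
move=> gen_p; rewrite -[RHS](raddf0 (@mxpi F n)); apply/mxpiE.
by rewrite subr0 mxgen_ideal.
Qed.

Lemma monomial_xvar (m : 'X_{1.. n * n}) : exists2 c : seq ('I_n * 'I_n),
  size c = mdeg m & 'X_[m] = \prod_(ij <- c) xvar F ij.1 ij.2.
Proof.
move def_d: (mdeg m) => d; elim: d => [|d IHd] in m def_d *.
  exists [::]; rewrite // big_nil; move/eqP: def_d.
  by rewrite mdeg_eq0 => /eqP ->; rewrite mpolyX0.
have /existsP[l ml] : [exists l, m l != 0%N].
  apply: contraTT isT => /existsPn m0; have : mdeg m = 0%N.
    by rewrite mdegE big1 // => l _; apply/eqP; rewrite -[_ == _]negbK m0.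
  by rewrite def_d.
have le_lm : (U_(l) <= m)%MM by rewrite lep1mP.
have def_m := submK le_lm.
have [|c size_c Xc] := IHd (m - U_(l))%MM.
  by move: def_d; rewrite -{1}def_m mdegD mdeg1 addn1 => -[].
case/mxvec_indexP: l => i j in le_lm def_m Xc ml *.
exists ((i, j) :: c); rewrite /= ?size_c //.
by rewrite big_cons /= -Xc -{1}def_m mpolyXD mulrC.
Qed.

Lemma prod_xvar_eq0 (c : seq ('I_n * 'I_n)) :
  ~~ (uniq (map fst c) && uniq (map snd c)) -> mxpi (\prod_(ij <- c) xvar F ij.1 ij.2) = 0.
Proof.
have mul0 (a b : 'I_n * 'I_n) : (a.1 == b.1) || (a.2 == b.2) ->
    mxpi (xvar F a.1 a.2 * xvar F b.1 b.2) = 0.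
  by move=> /orP[] /eqP ->; apply: mxpi_ideal0; constructor.
elim: c => //= a c IHc uniq_c; rewrite big_cons.
have [/IHc c0|/negPn/andP[uc1 uc2]] := boolP (~~ (uniq (map fst c) && uniq (map snd c))).
  by rewrite rmorphM /= c0 mulr0.
suff [b cb ab] : exists2 b, b \in c & (a.1 == b.1) || (a.2 == b.2).
  by rewrite (perm_big _ (perm_to_rem cb)) big_cons /= mulrA rmorphM /= mul0 ?mul0r.
move: uniq_c; rewrite uc1 uc2 !andbT negb_and !negbK => /orP[] /mapP[b cb ->].
  by exists b; rewrite ?eqxx.
by exists b; rewrite ?eqxx ?orbT.
Qed.

(** Monomials with a repeated row or column are zero, so only rook placements have to be checked. *)
Lemma mxquot_degree_ind k (P : mxquot F n -> Prop) :
    (forall a q q', P q -> P q' -> P (a *: q + q')) -> P 0 ->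
    (forall c : seq ('I_n * 'I_n), size c = k -> uniq (map fst c) -> uniq (map snd c) ->
       P (\prod_(ij <- c) mxpi (xvar F ij.1 ij.2))) ->
  forall q, mxquot_degree k q -> P q.
Proof.
move=> PD P0 Pc _ [p /dhomogP homog_p ->]; rewrite [p]mpolyE raddf_sum big_seq.
elim/big_rec: _ => [|m q pm Pq]; first exact: P0.
rewrite /= mxpiZ; apply: (PD) => //.
have [c size_c ->] := monomial_xvar m.
rewrite homog_p // in size_c.
have [/andP[uniq1 uniq2]|nuniq] := boolP (uniq (map fst c) && uniq (map snd c)).
  by rewrite rmorph_prod; exact: Pc.
by rewrite prod_xvar_eq0.
Qed.

Lemma mxquot_degree_gt_eq0 k q : (n < k)%N -> mxquot_degree (F := F) (n := n) k q -> q = 0.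
Proof.
move=> lt_nk; move: q; apply: mxquot_degree_ind => [a q q' -> ->||c size_c uniq1 _] //.
  by rewrite scaler0 addr0.
have := uniq_leq_size uniq1 (fun i _ => mem_enum 'I_n i); rewrite size_map size_c -cardE card_ord.
by rewrite leqNgt lt_nk.
Qed.

End Monomials.

(** * The degree k piece as an image of the tensor square of the group algebra *)

Section RookQuotient.

Variables (F : fieldType) (n k : nat).
Hypothesis fact_neq0 : (n`!)%:R != 0 :> F.
Hypothesis le_kn : (k <= n)%N.

Implicit Types (la mu : intpart n) (s t g w : 'S_n).
Local Notation G := [set: 'S_n]%G.
Local Notation N := (gcard G).
Local Notation galg := (group_ring F G).
Local Notation rho := (@rho F n).

(** When the first part of a shape is [n - k], these are the entries of its first row. *)
Definition low_set : {set 'I_n} := [set i : 'I_n | i < n - k]%N.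
Local Notation Z := low_set.
Local Notation D := (~: low_set).

Lemma card_low_set : #|Z| = (n - k)%N.
Proof.
rewrite cardE -(size_map (@nat_of_ord n)) -[RHS](size_iota 0); apply/perm_size/uniq_perm.
- by rewrite (map_inj_uniq val_inj) enum_uniq.
- exact: iota_uniq.
move=> i; rewrite mem_iota add0n /=; apply/mapP/idP => [[j + ->]|lt_i].
  by rewrite mem_enum inE.
by exists (Ordinal (leq_trans lt_i (leq_subr _ _))); rewrite ?mem_enum ?inE.
Qed.

Lemma card_low_setC : #|D| = k.
Proof.
have := cardsC Z; rewrite card_low_set card_ord => /(canRL (addKn _)).
by rewrite subKn.
Qed.

Definition low_group : {group 'S_n} := perm.Sym_group Z.
Local Notation H := low_group.

Lemma mem_low_group s : (s \in H) = perm_on Z s.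
Proof. by rewrite inE. Qed.

Definition rook_mon s t : mxpol F n := \prod_(i in D) xvar F (s i) (t i).

(** A matrix with rows and columns indexed by permutations stands for an element of A (X) A, where A
    is the group algebra. *)
Definition rook_poly (M : 'M[F]_N) : mxpol F n :=
  \sum_i \sum_j M i j *: rook_mon (enum_val i) (enum_val j).

Lemma rook_poly_is_linear : linear rook_poly.
Proof.
move=> a M M'; rewrite /rook_poly scaler_sumr -big_split; apply: eq_bigr => i _ /=.
rewrite scaler_sumr -big_split; apply: eq_bigr => j _ /=.
by rewrite !mxE scalerDl scalerA.
Qed.
HB.instance Definition _ :=
  GRing.isLinear.Build F 'M[F]_N (mxpol F n) *:%R rook_poly rook_poly_is_linear.

Lemma rook_poly_homog M : rook_poly M \is k.-homog.
Proof.
apply: rpred_sum => i _; apply: rpred_sum => j _; apply: rpredZ.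
suff: rook_mon (enum_val i) (enum_val j) \is (\sum_(l in D) 1%N).-homog.
  by rewrite sum1_card card_low_setC.
rewrite /rook_mon; elim/big_rec2: _ => [|l d p _ hp]; first exact: dhomog1.
by apply: dhomogM => //; rewrite dhomogX /= mdeg1.
Qed.

HB.instance Definition _ :=
  GRing.isScalable.Build F (mxpol F n) (mxquot F n) *:%R (@mxpi F n) (@mxpiZ F n).

Definition rook_elt (M : 'M[F]_N) : mxquot F n := mxpi (rook_poly M).

Lemma rook_elt_is_linear : linear rook_elt.
Proof. by move=> a M M'; rewrite /rook_elt linearP raddfD /= mxpiZ. Qed.
HB.instance Definition _ :=
  GRing.isLinear.Build F 'M[F]_N (mxquot F n) *:%R rook_elt rook_elt_is_linear.

Lemma rook_elt_degree M : mxquot_degree k (rook_elt M).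
Proof. by exists (rook_poly M); rewrite ?rook_poly_homog. Qed.

(** The pure tensor of [x] and [y], as the outer product of their coordinate rows. *)
Definition group_pair (x y : 'M[F]_N) : 'M[F]_N :=
  (gring_row (G := G) x)^T *m gring_row (G := G) y.

Lemma gring_row_rho s : gring_row (G := G) (rho s) = delta_mx 0 (gring_index G s).
Proof. by rewrite /gring_row rowK gring_indexK ?inE // mul1g. Qed.

Lemma rook_poly_pair s t : rook_poly (group_pair (rho s) (rho t)) = rook_mon s t.
Proof.
rewrite /group_pair !gring_row_rho trmx_delta mul_delta_mx /rook_poly.
rewrite (bigD1 (gring_index G s)) //= [X in _ + X]big1 ?addr0 => [|i neq_i].
  rewrite (bigD1 (gring_index G t)) //= [X in _ + X]big1 ?addr0 => [|j neq_j].
    by rewrite mxE !eqxx scale1r !gring_indexK ?inE.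
  by rewrite mxE (negPf neq_j) andbF scale0r.
by rewrite big1 // => j _; rewrite mxE (negPf neq_i) scale0r.
Qed.

Lemma group_pairDl a x x' y :
  group_pair (a *: x + x') y = a *: group_pair x y + group_pair x' y.
Proof. by rewrite /group_pair !linearP /= mulmxDl scalemxAl. Qed.

Lemma group_pairDr a x y y' :
  group_pair x (a *: y + y') = a *: group_pair x y + group_pair x y'.
Proof. by rewrite /group_pair linearP /= mulmxDr scalemxAr. Qed.

Lemma group_pair0l y : group_pair 0 y = 0.
Proof. by rewrite /group_pair linear0 trmx0 mul0mx. Qed.

Lemma group_pair0r x : group_pair x 0 = 0.
Proof. by rewrite /group_pair linear0 mulmx0. Qed.

Lemma group_pairZl a x y : group_pair (a *: x) y = a *: group_pair x y.
Proof. by rewrite -[a *: x]addr0 group_pairDl group_pair0l addr0. Qed.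

Lemma group_pairZr a x y : group_pair x (a *: y) = a *: group_pair x y.
Proof. by rewrite -[a *: y]addr0 group_pairDr group_pair0r addr0. Qed.

Lemma group_pair_sumr (I : finType) (P : pred I) x (y : I -> 'M[F]_N) :
  group_pair x (\sum_(i | P i) y i) = \sum_(i | P i) group_pair x (y i).
Proof. by rewrite /group_pair linear_sum mulmx_sumr. Qed.

Lemma group_pair_suml (I : finType) (P : pred I) (x : I -> 'M[F]_N) y :
  group_pair (\sum_(i | P i) x i) y = \sum_(i | P i) group_pair (x i) y.
Proof. by rewrite /group_pair !linear_sum /= mulmx_suml. Qed.

Lemma group_pair_mul x y z z' :
  group_pair (x *m z) (y *m z') = z^T *m group_pair x y *m z'.
Proof. by rewrite /group_pair !gring_row_mul trmx_mul !mulmxA. Qed.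

Lemma group_pair_span (P : 'M[F]_N -> Prop) :
    (forall a M M', P M -> P M' -> P (a *: M + M')) -> P 0 ->
  (forall s t, P (group_pair (rho s) (rho t))) -> forall M, P M.
Proof.
move=> PD P0 Prho M; rewrite [M]matrix_sum_delta.
elim/big_rec: _ => [|i X _ PX]; first exact: P0.
rewrite -[\sum_j _]scale1r; apply: (PD) => //.
elim/big_rec: _ => [|j Y _ PY]; first exact: P0.
apply: (PD) => //; have := Prho (enum_val i) (enum_val j).
by rewrite /group_pair !gring_row_rho trmx_delta mul_delta_mx !gring_valK.
Qed.

Local Notation yq := (fun i j : 'I_n => mxpi (xvar F i j)).

Lemma rook_relations_quot s t : rook_relations (fun i j => yq (s i) (t j)).
Proof.
split=> [i j j'|i i' j|i].
- by rewrite -rmorphM /=; apply: mxpi_ideal0; constructor.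
- by rewrite -rmorphM /=; apply: mxpi_ideal0; constructor.
- rewrite -[RHS](mxpi_ideal0 (MxgenRowSum F (s i))) raddf_sum [RHS](reindex_perm t).
  by [].
Qed.

Lemma rook_relations_quotT s t : rook_relations (fun i j => yq (t j) (s i)).
Proof.
split=> [i j j'|i i' j|i].
- by rewrite -rmorphM /=; apply: mxpi_ideal0; constructor.
- by rewrite -rmorphM /=; apply: mxpi_ideal0; constructor.
- rewrite -[RHS](mxpi_ideal0 (MxgenColSum F (s i))) raddf_sum [RHS](reindex_perm t).
  by [].
Qed.

Lemma rook_elt_pair s t : rook_elt (group_pair (rho s) (rho t)) = \prod_(i in D) yq (s i) (t i).
Proof. by rewrite /rook_elt rook_poly_pair rmorph_prod. Qed.

Lemma mxquot_act_is_linear (g : 'S_n * 'S_n) : linear (@mxquot_act F n g).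
Proof.
move=> a q q'; have [p ->] := mxpiP q; have [p' ->] := mxpiP q'.
by rewrite -mxpiZ -raddfD !mxquot_act_pi linearP raddfD /= mxpiZ.
Qed.
HB.instance Definition _ (g : 'S_n * 'S_n) :=
  GRing.isLinear.Build F (mxquot F n) (mxquot F n) *:%R
  (@mxquot_act F n g) (mxquot_act_is_linear g).

Lemma rook_elt_act (g : 'S_n * 'S_n) M :
  mxquot_act g (rook_elt M) = rook_elt ((rho g.1)^T *m M *m rho g.2).
Proof.
move: M; apply: group_pair_span => [a M M' EM EM'||s t].
- by rewrite mulmxDr mulmxDl -scalemxAr -scalemxAl !linearP /= EM EM'.
- by rewrite mulmx0 mul0mx !linear0.
rewrite -group_pair_mul -!rhoM [RHS]rook_elt_pair /rook_elt rook_poly_pair mxquot_act_pi.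
rewrite !rmorph_prod /=; apply: eq_bigr => i _.
by rewrite mxact_x !permM.
Qed.

(** Elements of [H] fix the indices occurring in R_0, so each of them contributes the same
    monomial. *)
Lemma rook_elt_mulr x y : (x \in galg)%MS -> (y \in galg)%MS ->
  rook_elt (group_pair x (sym_sum F H *m y)) = #|H|%:R *: rook_elt (group_pair x y).
Proof.
move=> Ax; move: y; apply: galg_ind => [a y y' E E'||t].
- by rewrite mulmxDr -scalemxAr !group_pairDr !linearP /= E E'.
- by rewrite mulmx0 !group_pair0r linear0 scaler0.
move: x Ax; apply: galg_ind => [a x x' E E'||s].
- by rewrite !group_pairDl !linearP /= E E'.
- by rewrite !group_pair0l linear0 scaler0.
rewrite mulmx_suml group_pair_sumr linear_sum /=.
rewrite (eq_bigr (fun _ => rook_elt (group_pair (rho s) (rho t)))) ?sumr_const ?scaler_nat //.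
move=> w; rewrite mem_low_group => Zw; rewrite -rhoM !rook_elt_pair.
by apply: eq_bigr => i; rewrite inE => nZ; rewrite permM (out_perm Zw nZ).
Qed.

(** For group elements this is [sum_perm_on_transpose] applied to the array of the classes of
    [x_(s i, t j)]. *)
Lemma rook_elt_swap x y z : (x \in galg)%MS -> (y \in galg)%MS -> (z \in galg)%MS ->
  rook_elt (group_pair x (y *m sym_sum F H *m z))
  = rook_elt (group_pair (y^T *m sym_sum F H *m x) z).
Proof.
move=> Ax Ay; move: z; apply: galg_ind => [a z z' E E'||t].
- by rewrite mulmxDr -scalemxAr !group_pairDr !linearP /= E E'.
- by rewrite mulmx0 !group_pair0r.
move: x Ax; apply: galg_ind => [a x x' E E'||s].
- by rewrite mulmxDr -scalemxAr !group_pairDl !linearP /= E E'.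
- by rewrite mulmx0 !group_pair0l.
move: y Ay; apply: galg_ind => [a y y' E E'||g].
- rewrite linearP /= !mulmxDl -!scalemxAl group_pairDl group_pairDr !linearP /= E E'.
  by [].
- by rewrite trmx0 !mul0mx group_pair0l group_pair0r.
rewrite trmx_rho -!mulmxA ![sym_sum F H *m _]mulmx_suml !mulmx_sumr.
rewrite group_pair_sumr group_pair_suml !linear_sum /=.
have := sum_perm_on_transpose g D (rook_relations_quot s t) (rook_relations_quotT t s).
rewrite setCK => E; transitivity (\sum_(w | perm_on Z w) \prod_(i in D) yq (s i) (t (w (g i)))).
  by apply: eq_big => [w|w _]; rewrite ?mem_low_group // -!rhoM rook_elt_pair;
     apply: eq_bigr => i _; rewrite !permM.
rewrite E; apply: eq_big => [w|w _]; rewrite ?mem_low_group // -!rhoM rook_elt_pair.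
by apply: eq_bigr => i _; rewrite !permM.
Qed.

(** For group elements this is [sum_perm_on_eq0]: fewer than [k] columns are left outside [Z']. *)
Lemma rook_elt_kill (Z' : {set 'I_n}) x y z : (#|~: Z'| < k)%N ->
    (x \in galg)%MS -> (y \in galg)%MS -> (z \in galg)%MS ->
  rook_elt (group_pair x (y *m sym_sum F (perm.Sym_group Z') *m z)) = 0.
Proof.
move=> lt_Z' Ax Ay; move: z; apply: galg_ind => [a z z' E E'||t].
- by rewrite mulmxDr -scalemxAr group_pairDr !linearP /= E E' scaler0 addr0.
- by rewrite mulmx0 !group_pair0r linear0.
move: x Ax; apply: galg_ind => [a x x' E E'||s].
- by rewrite !group_pairDl !linearP /= E E' scaler0 addr0.
- by rewrite !group_pair0l linear0.
move: y Ay; apply: galg_ind => [a y y' E E'||g].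
- by rewrite !mulmxDl -!scalemxAl group_pairDr !linearP /= E E' scaler0 addr0.
- by rewrite !mul0mx group_pair0r linear0.
rewrite -!mulmxA mulmx_suml mulmx_sumr group_pair_sumr linear_sum /=.
rewrite -{1}card_low_setC in lt_Z'.
rewrite -[RHS](sum_perm_on_eq0 (rook_relations_quot s t) g lt_Z').
apply: eq_big => [w|w _]; first by rewrite inE.
by rewrite -!rhoM rook_elt_pair; apply: eq_bigr => i _; rewrite !permM.
Qed.

(** * Evaluation at permutation matrices *)

Definition perm_point w : 'I_(n * n) -> F := mxvec (perm_mx w) 0.

Lemma perm_pointE w i j : perm_point w (mxvec_index i j) = (w i == j)%:R.
Proof. by rewrite /perm_point mxvecE !mxE. Qed.

Lemma meval_xvar w i j : (xvar F i j).@[perm_point w] = (w i == j)%:R.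
Proof. by rewrite mevalXU perm_pointE. Qed.

Definition perm_eval (p : mxpol F n) : 'M[F]_N := \sum_w p.@[perm_point w] *: rho w.

Lemma perm_eval_is_linear : linear perm_eval.
Proof.
move=> a p q; rewrite /perm_eval scaler_sumr -big_split; apply: eq_bigr => w _ /=.
by rewrite mevalD mevalZ scalerDl scalerA.
Qed.
HB.instance Definition _ :=
  GRing.isLinear.Build F (mxpol F n) 'M[F]_N *:%R perm_eval perm_eval_is_linear.

(** The monomial is 1 at [w] if [s w t^-1] fixes [D] pointwise, that is, lies in [H], and 0
    otherwise; hence the substitution [w = s^-1 u t]. *)
Lemma perm_eval_rook s t : perm_eval (rook_mon s t) = (rho s)^T *m sym_sum F H *m rho t.
Proof.
rewrite trmx_rho /sym_sum mulmx_sumr mulmx_suml /perm_eval [RHS]big_mkcond /=.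
have bij_st : bijective (fun u => s^-1 * u * t)%g.
  exists (fun w => s * w * t^-1)%g => u; first by rewrite !mulgA mulgV mul1g mulgK.
  by rewrite !mulgA mulVg mul1g mulgKV.
rewrite (reindex _ (onW_bij _ bij_st)); apply: eq_bigr => u _ /=.
rewrite /rook_mon rmorph_prod /=.
rewrite (eq_bigr (fun i => (u i == i)%:R)) => [|i _]; last first.
  by rewrite meval_xvar !permM permK (inj_eq perm_inj).
rewrite mem_low_group; case: ifPn => [Zu|nZu].
  rewrite big1 ?scale1r ?rhoM // => i; rewrite inE => nZ.
  by rewrite (out_perm Zu nZ) eqxx.
have /existsP[i /andP[Di ui]] : [exists i, (i \in D) && (u i != i)].
  rewrite -negb_forall_in; apply: contra nZu => /forall_inP uD.
  apply/subsetP => i; rewrite inE; apply: contraR => nZ; apply: uD.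
  by rewrite inE.
by rewrite (bigD1 i) //= (negPf ui) mul0r scale0r.
Qed.

Lemma perm_eval_pair x y : (x \in galg)%MS -> (y \in galg)%MS ->
  perm_eval (rook_poly (group_pair x y)) = x^T *m sym_sum F H *m y.
Proof.
move=> Ax; move: y; apply: galg_ind => [a y y' E E'||t].
- by rewrite group_pairDr !linearP /= E E'.
- by rewrite group_pair0r !linear0.
move: x Ax; apply: galg_ind => [a x x' E E'||s].
- by rewrite group_pairDl !linearP /= E E' !mulmxDl -!scalemxAl.
- by rewrite group_pair0l !linear0 !mul0mx.
by rewrite rook_poly_pair perm_eval_rook.
Qed.

(* A monomial of degree less than k leaves more than n - k = la_1 columns free,
   two of which lie in the same column of la; their transposition fixes the
   evaluation and changes the sign of col_alt la. *)
Lemma perm_eval_low m la : (mdeg m < k)%N -> largest_part la = (n - k)%N ->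
  perm_eval 'X_[m] *m col_alt F la = 0.
Proof.
move=> lt_m la_1.
pose A := [set j : 'I_n | [exists i, m (mxvec_index i j) != 0%N]].
have card_A : (#|A| <= mdeg m)%N.
  rewrite mdegE (reindex _ (curry_mxvec_bij n n)) /=.
  rewrite (eq_bigr (fun p => m (mxvec_index p.1 p.2))) => [|[i j] _ //].
  rewrite -(pair_bigA _ (fun i j => m (mxvec_index i j))) /= exchange_big -sum1_card big_mkcond.
  apply: leq_sum => j _; case: ifP => //; rewrite inE => /existsP[i mi].
  by rewrite (bigD1 i) //= (leq_trans _ (leq_addr _ _)) // lt0n.
have [j [j' [Aj Aj' neq_j eq_col]]] : exists j j' : 'I_n,
    [/\ j \notin A, j' \notin A, j != j' & cell_col la j = cell_col la j'].
  apply: contrapT => nex.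
  have : (#|~: A| <= n - k)%N.
    rewrite cardE -(size_map (cell_col la \o @nat_of_ord n)) -[leqRHS](size_iota 0).
    apply: uniq_leq_size => [|_ /mapP[i _ ->]]; last first.
      by rewrite mem_iota add0n -la_1 /= cell_col_largest.
    rewrite map_inj_in_uniq ?enum_uniq // => i i'; rewrite !mem_enum !inE => Ai Ai' /= eq_c.
    by apply/eqP; apply: contrapT => /negP neq_i; apply: nex; exists i, i'; rewrite !inE.
  rewrite leqNgt => /negP; apply; rewrite -(ltn_add2l #|A|) cardsC card_ord.
  by have := leq_ltn_trans card_A lt_m; rewrite -(ltn_add2r (n - k)) subnKC.
set b := col_alt F la; set X := perm_eval _.
have X_tau : X *m rho (tperm j j') = X.
  rewrite /X /perm_eval mulmx_suml [RHS](reindex_inj (mulIg (tperm j j'))).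
  apply: eq_bigr => w _; rewrite -scalemxAl -rhoM; congr (_ *: _).
  rewrite !mevalX !(reindex _ (curry_mxvec_bij n n)) /=; apply: eq_bigr => -[i c] _ /=.
  have [m0|m_neq0] := eqVneq (m (mxvec_index i c)) 0%N; first by rewrite !m0 !expr0.
  rewrite !perm_pointE permM; congr ((nat_of_bool _)%:R ^+ _).
  have Ac : c \in A by rewrite inE; apply/existsP; exists i.
  have cj : c != j by apply: contraNneq Aj => <-.
  have cj' : c != j' by apply: contraNneq Aj' => <-.
  by case: tpermP => [->|->|//]; rewrite eq_sym ?(negPf cj) ?(negPf cj') // eq_sym
     ?(negPf cj) ?(negPf cj').
have b_tau : rho (tperm j j') *m b = - b.
  rewrite /b /col_alt (@mul_rho_alt_sum _ _ (col_group la)) ?tperm_col_stab //.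
  by rewrite odd_tperm neq_j scaleN1r.
have Xb : X *m b = - (X *m b) by rewrite -{1}X_tau -mulmxA b_tau mulmxN.
apply/eqP; have /eqP : 2%:R *: (X *m b) = 0 by rewrite scaler_nat mulr2n {1}Xb addNr.
by rewrite scaler_eq0 (negPf (two_neq0 fact_neq0 neq_j)).
Qed.

(** At permutation matrices, products of two distinct variables in a line vanish, a square equals
    the variable, and row and column sums equal 1. So what does not vanish evaluates like a monomial
    of degree below [k], and [perm_eval_low] applies. *)
Lemma perm_eval_gen la m (g : mxpol F n) : largest_part la = (n - k)%N -> mxgen g ->
  perm_eval (pihomog mdeg k ('X_[m] * g)) *m col_alt F la = 0.
Proof.
move=> la_1 gen_g.
have homog_case d : g \is d.-homog ->
    ((mdeg m + d)%N = k -> perm_eval ('X_[m] * g) *m col_alt F la = 0) ->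
  perm_eval (pihomog mdeg k ('X_[m] * g)) *m col_alt F la = 0.
  move=> hg E; have hmg : 'X_[m] * g \is (mdeg m + d).-homog.
    by apply: dhomogM => //; rewrite dhomogX.
  have [eq_k|neq_k] := eqVneq (mdeg m + d)%N k; last first.
    by rewrite (pihomog_ne0 neq_k hmg) linear0 mul0mx.
  by rewrite -eq_k (pihomog_dE hmg) E.
have xh i j : xvar F i j \is 1.-homog by rewrite dhomogX /= mdeg1.
have sq_eval i j : perm_eval ('X_[m] * (xvar F i j * xvar F i j))
    = perm_eval 'X_[m + U_(mxvec_index i j)].
  rewrite /perm_eval; apply: eq_bigr => w _; rewrite mpolyXD !mevalM !meval_xvar.
  by case: (_ == _); rewrite ?mulr1 ?mulr0.
have sq_case i j : (mdeg m + 2)%N = k ->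
    perm_eval ('X_[m] * (xvar F i j * xvar F i j)) *m col_alt F la = 0.
  move=> eq_k; rewrite sq_eval perm_eval_low // mdegD mdeg1 -eq_k.
  by rewrite ltn_add2l.
case: gen_g homog_case => [i j j'|i i' j|i|j] homog_case.
- apply: (homog_case 2%N) => [|eq_k]; first by rewrite -[2%N]/(1 + 1)%N; apply: dhomogM.
  have [->|neq_j] := eqVneq j j'; first exact: sq_case.
  rewrite /perm_eval big1 ?mul0mx // => w _; rewrite !mevalM !meval_xvar.
  by case: eqP => [->|_]; rewrite ?(negPf neq_j) ?mul0r ?mulr0 ?scale0r.
- apply: (homog_case 2%N) => [|eq_k]; first by rewrite -[2%N]/(1 + 1)%N; apply: dhomogM.
  have [->|neq_i] := eqVneq i i'; first exact: sq_case.
  rewrite /perm_eval big1 ?mul0mx // => w _; rewrite !mevalM !meval_xvar.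
  case: eqP => [wi|_]; last by rewrite mul0r mulr0 scale0r.
  by rewrite -wi (inj_eq perm_inj) eq_sym (negPf neq_i) !mulr0 scale0r.
- apply: (homog_case 1%N) => [|eq_k]; first by apply: rpred_sum => l _; exact: xh.
  suff -> : perm_eval ('X_[m] * \sum_j xvar F i j) = perm_eval 'X_[m].
    by rewrite perm_eval_low // -eq_k addn1.
  rewrite /perm_eval; apply: eq_bigr => w _; rewrite mevalM raddf_sum /= (bigD1 (w i)) //=.
  rewrite meval_xvar eqxx big1 ?addr0 ?mulr1 // => j neq_j.
  by rewrite meval_xvar eq_sym (negPf neq_j).
- apply: (homog_case 1%N) => [|eq_k]; first by apply: rpred_sum => l _; exact: xh.
  suff -> : perm_eval ('X_[m] * \sum_i xvar F i j) = perm_eval 'X_[m].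
    by rewrite perm_eval_low // -eq_k addn1.
  rewrite /perm_eval; apply: eq_bigr => w _; rewrite mevalM raddf_sum /= (bigD1 (w^-1%g j)) //=.
  rewrite meval_xvar permKV eqxx big1 ?addr0 ?mulr1 // => i neq_i.
  rewrite meval_xvar; case: eqP => // wi; case/negP: neq_i.
  by rewrite -wi permK.
Qed.

(** The ideal membership need not be homogeneous, so [p] is replaced by its degree [k] component,
    taken term by term. *)
Lemma perm_eval_ideal la p : largest_part la = (n - k)%N -> p \in @mxideal F n ->
  p \is k.-homog -> perm_eval p *m col_alt F la = 0.
Proof.
move=> la_1 /mxidealP[s gen_s def_p] /pihomog_dE <-; rewrite def_p.
move: (col_alt F la) (perm_eval_gen (la := la)) => b gen.
have gen0 m (g : mxpol F n) : mxgen g ->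
    perm_eval (pihomog mdeg k ('X_[m] * g)) *m b = 0.
  exact: gen.
have sumE (I : Type) (r : seq I) (f : I -> mxpol F n) :
    perm_eval (pihomog mdeg k (\sum_(i <- r) f i))
    = \sum_(i <- r) perm_eval (pihomog mdeg k (f i)).
  by rewrite (linear_sum (pihomog mdeg k)) linear_sum.
rewrite sumE mulmx_suml big_seq big1 // => -[c g] /gen_s /= gen_g.
rewrite [c]mpolyE mulr_suml sumE mulmx_suml big1 // => m _.
by rewrite -scalerAl linearZ /= linearZ /= -scalemxAl gen0 ?scaler0.
Qed.

Lemma rook_elt_pair_eq0 la x y : largest_part la = (n - k)%N ->
    (x \in galg)%MS -> (y \in galg)%MS -> rook_elt (group_pair x y) = 0 ->
  x^T *m sym_sum F H *m y *m col_alt F la = 0.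
Proof.
move=> la_1 Ax Ay xy0; rewrite -perm_eval_pair // perm_eval_ideal ?rook_poly_homog //.
by rewrite -[rook_poly _]subr0; apply/mxpiE; rewrite raddf0.
Qed.

(** Each rook placement is a translate of R_0: its rows and its columns, listed along the last [k]
    indices, extend to permutations. *)
Lemma rook_elt_surj (i0 : 'I_n) (c : seq ('I_n * 'I_n)) : size c = k ->
    uniq (map fst c) -> uniq (map snd c) ->
  exists M, rook_elt M = \prod_(ij <- c) mxpi (xvar F ij.1 ij.2).
Proof.
move=> size_c uniq1 uniq2; pose c0 := (i0, i0).
have ext (f : 'I_n * 'I_n -> 'I_n) : uniq (map f c) ->
    exists s, forall i, i \in D -> s i = f (nth c0 c (i - (n - k))).
  move=> uniq_f; have D_lt (i : 'I_n) : i \in D -> (i - (n - k) < size c)%N.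
    rewrite !inE -leqNgt => le_i; rewrite size_c ltn_subLR // subnK //.
  have [|||s _ sE] := @perm_extension n 1%g (fun i => f (nth c0 c (i - (n - k)))) D setT.
  - move=> i j Di Dj; rewrite -!(nth_map c0 i0 f) ?D_lt // => /eqP.
    rewrite nth_uniq ?size_map ?D_lt // => /eqP eq_ij; apply: val_inj => /=.
    by move: Di Dj; rewrite !inE -!leqNgt => /subnK <- /subnK <-; rewrite eq_ij.
  - by move=> i _; rewrite inE.
  - by move=> i _; rewrite inE.
  by exists s => i Di; rewrite -sE // perm1.
have [s sE] := ext fst uniq1; have [t tE] := ext snd uniq2.
exists (group_pair (rho s) (rho t)); rewrite rook_elt_pair.
pose y l := mxpi (xvar F (nth c0 c l).1 (nth c0 c l).2).
rewrite (eq_bigr (fun i : 'I_n => y (i - (n - k))%N)) => [|i Di]; last by rewrite sE ?tE.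
rewrite [RHS](big_nth c0) size_c.
transitivity (\prod_(0 <= l < n - (n - k)) y l); last by rewrite subKn.
have := big_addn 0 n (n - k) xpredT (fun l => y (l - (n - k))%N) (op := *%R) (idx := 1).
rewrite add0n big_geq_mkord /= => E.
transitivity (\prod_(i < n | (n - k <= i)%N) y (i - (n - k))%N).
  by apply: eq_bigl => i; rewrite !inE -leqNgt.
by rewrite E; apply: eq_bigr => i _; rewrite addnK.
Qed.
End RookQuotient.

(** * Tensor products and direct sums of representations *)

Section TensorCoordinates.

Variable F : fieldType.

Lemma tprod_linearl m1 n1 m2 n2 (B : 'M[F]_(m2, n2)) a (A A' : 'M[F]_(m1, n1)) :
  tprod (a *: A + A') B = a *: tprod A B + tprod A' B.
Proof.
elim: m1 A A' => [|m1 IHm] A A' /=; first by rewrite scaler0 addr0.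
by rewrite !linearP /= IHm -!trowbE linearP scale_col_mx add_col_mx.
Qed.

Lemma tprod_linearr m1 n1 m2 n2 (A : 'M[F]_(m1, n1)) a (B B' : 'M[F]_(m2, n2)) :
  tprod A (a *: B + B') = a *: tprod A B + tprod A B'.
Proof.
elim: m1 A => [|m1 IHm] A /=; first by rewrite scaler0 addr0.
by rewrite IHm linearP scale_col_mx add_col_mx.
Qed.

Lemma tprod0l m1 n1 m2 n2 (B : 'M[F]_(m2, n2)) : tprod (0 : 'M[F]_(m1, n1)) B = 0.
Proof.
have := tprod_linearl B (-1) 0 (0 : 'M_(m1, n1)).
by rewrite scaler0 addr0 scaleN1r addNr.
Qed.

Lemma tprod0r m1 n1 m2 n2 (A : 'M[F]_(m1, n1)) : tprod A (0 : 'M[F]_(m2, n2)) = 0.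
Proof.
have := tprod_linearr A (-1) 0 (0 : 'M_(m2, n2)).
by rewrite scaler0 addr0 scaleN1r addNr.
Qed.

Lemma tprod_suml m1 n1 m2 n2 (I : finType) (c : I -> F)
    (A : I -> 'M[F]_(m1, n1)) (B : 'M[F]_(m2, n2)) :
  tprod (\sum_i c i *: A i) B = \sum_i c i *: tprod (A i) B.
Proof.
apply: (big_ind2 (fun X Y => tprod X B = Y)) => [|X Y X' Y' <- <-|i _]; first exact: tprod0l.
  by rewrite -[X in X + X']scale1r tprod_linearl scale1r.
by rewrite -[_ *: A i]addr0 tprod_linearl tprod0l addr0.
Qed.

Lemma tprod_sumr m1 n1 m2 n2 (I : finType) (c : I -> F)
    (A : 'M[F]_(m1, n1)) (B : I -> 'M[F]_(m2, n2)) :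
  tprod A (\sum_i c i *: B i) = \sum_i c i *: tprod A (B i).
Proof.
apply: (big_ind2 (fun X Y => tprod A X = Y)) => [|X Y X' Y' <- <-|i _]; first exact: tprod0r.
  by rewrite -[X in X + X']scale1r tprod_linearr scale1r.
by rewrite -[_ *: B i]addr0 tprod_linearr tprod0r addr0.
Qed.

(** [tprod] is defined by recursion on blocks; pairing with tensor products of columns reads off
    coordinates without its index bijection. *)
Definition tens_entry d1 d2 (v : 'rV[F]_(d1 * d2)) (A : 'cV[F]_d1) (B : 'cV[F]_d2) : F :=
  (v *m tprod A B : 'M[F]_(1, 1 * 1)) 0 (0 : 'I_1).

Definition tens_coord d1 d2 (v : 'rV[F]_(d1 * d2)) : 'M[F]_(d1, d2) :=
  \matrix_(i, j) tens_entry v (delta_mx i 0) (delta_mx j 0).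

Lemma tens_coord_is_linear d1 d2 : linear (@tens_coord d1 d2).
Proof.
move=> a u v; apply/matrixP => i j; rewrite !mxE /tens_entry mulmxDl -scalemxAl.
by rewrite !mxE.
Qed.
HB.instance Definition _ d1 d2 := GRing.isLinear.Build F 'rV[F]_(d1 * d2) 'M[F]_(d1, d2) *:%R
  (@tens_coord d1 d2) (@tens_coord_is_linear d1 d2).

Lemma tens_entryE d1 d2 (v : 'rV[F]_(d1 * d2)) (A : 'cV[F]_d1) (B : 'cV[F]_d2) :
  tens_entry v A B = \sum_i \sum_j A i 0 * tens_coord v i j * B j 0.
Proof.
have EA : A = \sum_i A i 0 *: delta_mx i 0.
  by rewrite {1}[A]matrix_sum_delta; apply: eq_bigr => i _; rewrite big_ord1.
have EB : B = \sum_i B i 0 *: delta_mx i 0.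
  by rewrite {1}[B]matrix_sum_delta; apply: eq_bigr => i _; rewrite big_ord1.
rewrite {1}EA {1}EB /tens_entry tprod_suml mulmx_sumr summxE; apply: eq_bigr => i _.
rewrite tprod_sumr scaler_sumr mulmx_sumr summxE; apply: eq_bigr => j _.
by rewrite scalerA -scalemxAr [LHS]mxE [tens_coord v i j]mxE -/(tens_entry v _ _) mulrAC.
Qed.

Lemma tens_coord_tprod d1 d2 (v : 'rV[F]_(d1 * d2)) (A : 'M[F]_d1) (B : 'M[F]_d2) :
  tens_coord (v *m tprod A B) = A^T *m tens_coord v *m B.
Proof.
apply/matrixP => i j; rewrite !mxE /tens_entry -mulmxA -tprodE -!colE.
rewrite -/(tens_entry _ _ _) tens_entryE exchange_big; apply: eq_bigr => l _ /=.
rewrite !mxE mulr_suml; apply: eq_bigr => h _.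
by rewrite !mxE.
Qed.

(** Writing both identity matrices as sums of products of a basis column and a basis row expresses
    [v] through its coordinates. *)
Lemma tens_coord_inj d1 d2 : injective (@tens_coord d1 d2).
Proof.
apply: raddf_inj => v v0.
have sum1 d : 1%:M = \sum_(i < d) 1 *: ((delta_mx i 0 : 'cV[F]_d) *m (delta_mx 0 i : 'rV[F]_d)).
  rewrite [LHS]matrix_sum_delta; apply: eq_bigr => i _.
  rewrite (bigD1 i) //= big1 => [|j neq_j].
    by rewrite !mxE eqxx mul_delta_mx addr0.
  by rewrite !mxE eq_sym (negPf neq_j) scale0r.
rewrite -[v]mulmx1 -tprod1 {1}sum1 tprod_suml mulmx_sumr big1 // => i _.
rewrite {1}sum1 tprod_sumr scaler_sumr mulmx_sumr big1 // => j _.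
have /matrixP/(_ i j) := v0; rewrite !mxE /tens_entry => v0ij.
set A := tprod (delta_mx i 0) (delta_mx j 0) in v0ij.
have vA0 : (v *m A : 'M[F]_1) = 0 by rewrite [LHS]mx11_scalar [X in X%:M]v0ij raddf0.
rewrite tprodE !scale1r mulmxA.
pose B := tprod (delta_mx 0 i : 'rV[F]_d1) (delta_mx 0 j : 'rV[F]_d2).
by have := congr1 (fun Y : 'M[F]_(1, 1 * 1) => Y *m B) vA0; rewrite mul0mx.
Qed.

Lemma tens_coord_pure d1 d2 (u : 'rV[F]_d1) (w : 'rV[F]_d2) :
  exists v, tens_coord v = u^T *m w.
Proof.
exists (tprod u w : 'M[F]_(1 * 1, _)); apply/matrixP => i j; rewrite !mxE big_ord1 mxE.
transitivity ((tprod (u *m delta_mx i 0) (w *m delta_mx j 0) : 'M[F]_(1 * 1))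
  (0 : 'I_1) (0 : 'I_1)).
  by rewrite tprodE.
rewrite -!colE; transitivity (\tr (tprod (col i u) (col j w))).
  exact: esym (trace_mx11 (tprod (col i u) (col j w) : 'M[F]_1)).
by rewrite mxtrace_prod !trace_mx11 !mxE.
Qed.

End TensorCoordinates.

Section DirectSum.

Variables (F : fieldType) (gT : finGroupType) (G : {group gT}) (V : lmodType F) (I : eqType).
Variables (act : gT -> V -> V) (rep : I -> representation F G).
Variable phi : forall i, {linear 'rV[F]_(rdegree (rep i)) -> V}.
Hypothesis act_linear : forall g, linear (act g).
Hypothesis phi_equiv : forall i g v, phi i (v *m rep i g) = act g (phi i v).

(** For duplicate-free [r] this says both that each [phi i] is injective and that the images are in
    direct sum. *)
Definition independent_images (r : seq I) := forall v : forall i, 'rV[F]_(rdegree (rep i)),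
  \sum_(i <- r) phi i (v i) = 0 -> forall i, i \in r -> v i = 0.

(** Glues the maps [phi i] by induction on [r], splitting a row vector into its two blocks. This
    reduces the isomorphism to a description of the image and to independence. *)
Lemma dadd_grepr_map (r : seq I) (W := \big[dadd_grepr/grepr0]_(i <- r) rep i) : uniq r ->
  exists Phi : {linear 'rV[F]_(rdegree W) -> V},
    [/\ forall g v, Phi (v *m W g) = act g (Phi v),
        forall q, (exists v, Phi v = q) <->
          exists v : forall i, 'rV[F]_(rdegree (rep i)), q = \sum_(i <- r) phi i (v i)
      & independent_images r -> injective Phi].
Proof.
rewrite {}/W; elim: r => [_|i0 r IHr /= /andP[i0r uniq_r]].
  rewrite big_nil; have lin0 : linear (fun _ : 'rV[F]_0 => 0 : V).
    by move=> a u v; rewrite scaler0 addr0.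
  pose Phi0 : {linear 'rV[F]_0 -> V} :=
    HB.pack (fun _ : 'rV[F]_0 => 0 : V) (GRing.isLinear.Build F _ V *:%R _ lin0).
  exists Phi0; split=> [g v|q|_ u v _] /=.
  - by have := act_linear g (-1) 0 0; rewrite scaler0 addr0 scaleN1r addNr.
  - split=> [[v <-]|[v ->]]; last by exists 0; rewrite big_nil.
    by exists (fun=> 0); rewrite big_nil.
  - by apply/rowP => -[].
have [Phi [Phi_equiv Phi_im Phi_inj]] := IHr uniq_r.
rewrite big_cons; set W := \big[_/_]_(i <- r) _ in Phi Phi_equiv Phi_im Phi_inj *.
pose Psi (v : 'rV[F]_(rdegree (rep i0) + rdegree W)) := phi i0 (lsubmx v) + Phi (rsubmx v).
have lin : linear Psi by move=> a u v; rewrite /Psi !linearP scalerDr addrACA.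
pose Psi' : {linear 'rV[F]_(rdegree (rep i0) + rdegree W) -> V} :=
  HB.pack Psi (GRing.isLinear.Build F _ V *:%R _ lin).
have sum_out (v : forall i, 'rV[F]_(rdegree (rep i))) (u : 'rV_(rdegree (rep i0))) :
    \sum_(i <- r) phi i (dfwith v u i) = \sum_(i <- r) phi i (v i) :> V.
  apply: eq_big_seq => i ir; rewrite dfwith_out //.
  by apply: contraNneq i0r => eq_i; move: ir; rewrite eq_i.
exists Psi'; split=> [g v|q|indep].
- have -> : v *m dadd_grepr (rep i0) W g = row_mx (lsubmx v *m rep i0 g) (rsubmx v *m W g).
    by rewrite -{1}[v]hsubmxK /= mul_row_block !mulmx0 addr0 add0r.
  rewrite /= /Psi row_mxKl row_mxKr phi_equiv Phi_equiv.
  by rewrite -[act g (phi _ _)]scale1r -act_linear scale1r.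
- split=> [[v <-]|[v ->]].
    have [u Eu] := (Phi_im (Phi (rsubmx v))).1 (ex_intro _ _ erefl).
    exists (dfwith u (lsubmx v)); rewrite big_cons dfwith_in sum_out -Eu.
    by [].
  have [u Eu] := (Phi_im (\sum_(i <- r) phi i (v i))).2 (ex_intro _ v erefl).
  by exists (row_mx (v i0) u); rewrite /= /Psi row_mxKl row_mxKr Eu big_cons.
- have indep_r : independent_images r.
    move=> v sum0 i ir; have := indep (dfwith v (0 : 'rV_(rdegree (rep i0)))).
    rewrite big_cons dfwith_in sum_out linear0 add0r => /(_ sum0 i).
    rewrite inE ir orbT dfwith_out; first by apply.
    by apply: contraNneq i0r => eq_i; move: ir; rewrite eq_i.
  apply: raddf_inj => v; rewrite /= /Psi => v0.
  have [u Eu] := (Phi_im (Phi (rsubmx v))).1 (ex_intro _ _ erefl).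
  have all0 := indep (dfwith u (lsubmx v)).
  rewrite big_cons dfwith_in sum_out -Eu in all0.
  have l0 : lsubmx v = 0 by have := all0 v0 i0 (mem_head _ _); rewrite dfwith_in.
  have r0 : rsubmx v = 0.
    apply: (Phi_inj indep_r); rewrite [RHS]linear0.
    by move: v0; rewrite l0 linear0 add0r.
  by rewrite -[v]hsubmxK l0 r0 row_mx0.
Qed.

End DirectSum.

(** * Isotypic components *)

Section Components.

Variables (F : fieldType) (n k : nat).
Hypothesis fact_neq0 : (n`!)%:R != 0 :> F.
Variable i0 : 'I_n.

Implicit Types (la mu : intpart n) (s t g w : 'S_n).
Local Notation G := [set: 'S_n]%G.
Local Notation N := (gcard G).
Local Notation galg := (group_ring F G).
Local Notation rho := (@rho F n).
Local Notation row := (@gring_row F _ G).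
Local Notation young := (@young F n).
Local Notation col_alt := (@col_alt F n).
Local Notation row_sym := (@row_sym F n).
Local Notation H := (low_group n k).
Local Notation h := (sym_sum F H).
Local Notation elt := (@rook_elt F n k).
Local Notation pair := (@group_pair F n).

(** Left multiplication by [b] on coordinate rows; it commutes with the right regular
    representation. *)
Definition lmul (b : 'M[F]_N) : 'M[F]_N := \matrix_i row (b *m rho (enum_val i)).

Lemma row_lmul b x : (x \in galg)%MS -> row x *m lmul b = row (b *m x).
Proof.
move: x; apply: galg_ind => [a x y Ex Ey||s].
- by rewrite linearP mulmxDl -scalemxAl Ex Ey mulmxDr -scalemxAr linearP.
- by rewrite mulmx0 !linear0 mul0mx.
by rewrite gring_row_rho -rowE rowK gring_indexK ?inE.
Qed.

Lemma lmul_rho b g : lmul b *m rho g = rho g *m lmul b.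
Proof.
apply/row_matrixP => i; rewrite !row_mul rowK -gring_row_mul -mulmxA -rhoM.
have -> : matrix.row i (rho g) = row (rho (enum_val i * g)%g).
  by rewrite gring_row_rho; exact: rowK.
by rewrite row_lmul ?rho_galg.
Qed.

Lemma lmul_galg b x : (x \in galg)%MS -> lmul b *m x = x *m lmul b.
Proof.
move: x; apply: galg_ind => [a x y Ex Ey||s]; last exact: lmul_rho.
  by rewrite mulmxDr mulmxDl -scalemxAr -scalemxAl Ex Ey.
by rewrite mulmx0 mul0mx.
Qed.

Section Shape.

Variable la : intpart n.
Local Notation e := (young la).
Local Notation b := (col_alt la).
Local Notation U := (row_base (cyclic_mx (regular_repr F G) (young_symmetrizer F la))).
Local Notation d := (\rank (cyclic_mx (regular_repr F G) (young_symmetrizer F la))).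

Lemma row_module_basis i : exists2 x, (x \in galg)%MS & matrix.row i U = row (e *m x).
Proof.
have := row_sub i U; rewrite eq_row_base => /cyclic_mxP[x Ax ->].
by exists x => //; rewrite gring_row_mul.
Qed.

Lemma row_in_module x : (x \in galg)%MS -> exists w : 'rV[F]_d, row (e *m x) = w *m U.
Proof.
move=> Ax; apply/submxP; rewrite eq_row_base.
by apply/cyclic_mxP; exists x => //; rewrite gring_row_mul.
Qed.

(* The image of e x (X) e y is the class of R_0 (b e x (X) e y), where R_0 is the
   rook monomial on the last k diagonal cells. *)
Definition comp_map (v : 'rV[F]_(d * d)) : mxquot F n :=
  elt ((U *m lmul b)^T *m tens_coord v *m U).

Lemma comp_map_is_linear : linear comp_map.
Proof.
by move=> a u v; rewrite /comp_map linearP mulmxDr mulmxDl -scalemxAr -scalemxAl linearP.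
Qed.
HB.instance Definition _ :=
  GRing.isLinear.Build F 'rV[F]_(d * d) (mxquot F n) *:%R comp_map comp_map_is_linear.

Lemma irrS_basis g : irrS F la g *m U = U *m rho g.
Proof.
have := val_submodJ (cyclic_mx_module (regular_repr F G) (young_symmetrizer F la))
  (1%:M : 'M_d) (in_setT g).
by rewrite /= /val_submod /= !mul1mx.
Qed.

(** As [lmul b] commutes with the right regular action, [U] and [U *m lmul b] both intertwine [irrS]
    with it. *)
Lemma comp_map_equiv (g : 'S_n * 'S_n) v :
  comp_map (v *m outer_repr (irrS F la) (irrS F la) g) = mxquot_act g (comp_map v).
Proof.
rewrite /comp_map rook_elt_act /= tens_coord_tprod; congr (elt _).
have -> : (rho g.1)^T *m ((U *m lmul b)^T *m tens_coord v *m U) *m rho g.2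
    = (U *m lmul b *m rho g.1)^T *m tens_coord v *m (U *m rho g.2).
  by rewrite [in RHS]trmx_mul !mulmxA.
have -> : U *m lmul b *m rho g.1 = irrS F la g.1 *m (U *m lmul b).
  by rewrite -mulmxA lmul_rho mulmxA -irrS_basis -mulmxA.
by rewrite -irrS_basis [in RHS]trmx_mul !mulmxA.
Qed.

Lemma comp_map_pair x y : (x \in galg)%MS -> (y \in galg)%MS ->
  exists v, comp_map v = elt (pair (b *m e *m x) (e *m y)).
Proof.
move=> Ax Ay; have [w Ew] := row_in_module Ax; have [w' Ew'] := row_in_module Ay.
have [v Ev] := tens_coord_pure w w'; exists v.
rewrite /comp_map Ev /group_pair -(mulmxA b) -(row_lmul b (galgM (young_galg F la) Ax)).
by rewrite Ew Ew' !trmx_mul !mulmxA.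
Qed.

End Shape.

Hypothesis le_kn : (k <= n)%N.

(** The first [n - k] entries all lie in the first row, so [H] is contained in the row group. *)
Lemma sym_low_row_sym la : (n - k <= largest_part la)%N ->
  h *m row_sym la = #|H|%:R *: row_sym la.
Proof.
move=> le_la; apply: (@sym_sum_sub F n H (row_group la)).
apply/subsetP => s; rewrite mem_low_group inE => Zs; apply/forallP => i.
have [Zi|nZi] := boolP (i \in low_set n k); last by rewrite (out_perm Zs nZi).
have row0 (j : 'I_n) : j \in low_set n k -> cell_row la j = 0%N.
  by rewrite inE => lt_j; rewrite cell_row_first // (leq_trans lt_j).
by rewrite -!/(cell_row la _) !row0 // perm_closed.
Qed.

Lemma sym_low_young la : (n - k <= largest_part la)%N ->
  h *m young la = #|H|%:R *: young la.
Proof.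
move=> le_la; have -> : young la = row_sym la *m col_alt la by [].
by rewrite mulmxA sym_low_row_sym // scalemxAl.
Qed.

Lemma card_low_neq0 : #|H|%:R != 0 :> F.
Proof. exact: card_group_neq0. Qed.

(** Evaluation at permutation matrices would give [b a b e b = 0], up to the factor [#|H|].
    Multiplying by [a] on the left and using that [b b] is a nonzero multiple of [b] gives
    [e e e = 0], against [young_sq]. *)
Lemma comp_gen_neq0 la : largest_part la = (n - k)%N ->
  elt (pair (col_alt la *m young la) (young la)) != 0.
Proof.
move=> la_1; apply/negP => /eqP q0.
have Ae := young_galg F la; have Ab := col_alt_galg F la.
have [c c_neq0 sq_e] := young_sq fact_neq0 la.
have := rook_elt_pair_eq0 fact_neq0 le_kn la_1 (galgM Ab Ae) Ae q0.
rewrite trmx_mul (trmx_alt_sum F (col_group la)) trmx_young -/(col_alt la).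
rewrite -[X in X *m _]mulmxA sym_low_young ?la_1 // -scalemxAr -scalemxAl.
set a := row_sym la; set b := col_alt la => /eqP.
rewrite scaler_eq0 (negPf card_low_neq0) /= => /eqP z.
have bb : b *m b = #|col_group la|%:R *: b by exact: (alt_sum_sq F (col_group la)).
have ab : a *m b = young la by [].
have : young la *m young la *m young la = 0.
  apply/eqP; rewrite -(inj_eq (scalerI (card_group_neq0 fact_neq0 (col_group la)))) scaler0.
  have := congr1 (mulmx a) z; rewrite mulmx0 => <-; apply/eqP.
  transitivity (young la *m young la *m (young la *m b)); last by rewrite -ab !mulmxA.
  by rewrite -ab -[a *m b *m b]mulmxA bb -!scalemxAr.
rewrite sq_e -scalemxAl sq_e => /eqP; rewrite !scaler_eq0 (negPf c_neq0) /=.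
by rewrite (negPf (young_neq0 fact_neq0 la)).
Qed.

(** The symmetric group of the first [largest_part mu] indices lies in the row group, so its
    symmetrizer can be inserted before [young mu] up to an invertible factor; [rook_elt_kill]
    applies. *)
Lemma elt_pair_high mu x y : (n - k < largest_part mu)%N ->
    (x \in galg)%MS -> (y \in galg)%MS ->
  elt (pair x (y *m young mu)) = 0.
Proof.
move=> lt_mu Ax Ay; pose Z' : {set 'I_n} := [set i : 'I_n | i < largest_part mu]%N.
have card_Z' : #|Z'| = largest_part mu.
  have := card_low_set n (n - largest_part mu).
  by rewrite /low_set subKn ?largest_part_le.
have lt_Z' : (#|~: Z'| < k)%N.
  by rewrite -(ltn_add2l #|Z'|) cardsC card_ord card_Z' addnC -ltn_subLR.
have sub_Z' : perm.Sym_group Z' \subset row_group mu.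
  apply/subsetP => s; rewrite !inE => Zs; apply/forallP => i.
  have [Zi|nZi] := boolP (i \in Z'); last by rewrite (out_perm Zs nZi).
  have row0 (j : 'I_n) : j \in Z' -> cell_row mu j = 0%N.
    by rewrite inE => lt_j; rewrite cell_row_first.
  by rewrite -!/(cell_row mu _) !row0 // perm_closed.
have := rook_elt_kill le_kn lt_Z' Ax Ay (young_galg F mu).
have -> : young mu = row_sym mu *m col_alt mu by [].
rewrite -[y *m _ *m _]mulmxA (mulmxA (sym_sum F _)).
rewrite (sym_sum_sub F sub_Z') -scalemxAl -scalemxAr group_pairZr linearZ /= => /eqP.
by rewrite scaler_eq0 (negPf (card_group_neq0 fact_neq0 _)) => /eqP.
Qed.

(** Two of the first [n - k] entries are sent by [g] to the same column of [mu], as there are fewer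
    columns. *)
Lemma sym_low_kill mu y : (largest_part mu < n - k)%N -> (y \in galg)%MS ->
  h *m y *m col_alt mu = 0.
Proof.
move=> lt_mu; move: y; apply: galg_ind => [a x y Ex Ey||g].
- by rewrite mulmxDr mulmxDl -scalemxAr -scalemxAl Ex Ey scaler0 addr0.
- by rewrite mulmx0 mul0mx.
suff [i [j [Zi Zj neq_ij eq_c]]] : exists i j : 'I_n,
    [/\ i \in low_set n k, j \in low_set n k, i != j & cell_col mu (g i) = cell_col mu (g j)].
  apply: (sym_alt_kill fact_neq0 (K := col_group mu) neq_ij); last exact: tperm_col_stab.
  rewrite mem_low_group; apply/subsetP => l; rewrite inE.
  by case: tpermP => [->|->|]; rewrite ?eqxx.
apply: contrapT => nex; move: lt_mu; rewrite ltnNge => /negP; apply.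
rewrite -(card_low_set n k) cardE -(size_map (fun i => cell_col mu (g i))).
rewrite -[leqRHS](size_iota 0).
apply: uniq_leq_size => [|_ /mapP[i _ ->]]; last by rewrite mem_iota add0n /= cell_col_largest.
rewrite map_inj_in_uniq ?enum_uniq // => i j; rewrite !mem_enum => Zi Zj eq_c.
by apply/eqP; apply: contrapT => /negP neq_ij; apply: nex; exists i, j.
Qed.

(** By [rook_elt_mulr] the symmetrizer [h] may be inserted up to an invertible factor, and
    [sym_low_kill] applies. *)
Lemma elt_pair_low mu x y : (largest_part mu < n - k)%N ->
    (x \in galg)%MS -> (y \in galg)%MS ->
  elt (pair x (y *m young mu)) = 0.
Proof.
move=> lt_mu Ax Ay.
have := rook_elt_mulr k Ax (galgM Ay (young_galg F mu)).
have -> : h *m (y *m young mu) = h *m (y *m row_sym mu) *m col_alt mu by rewrite !mulmxA.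
rewrite sym_low_kill ?galgM ?row_sym_galg // group_pair0r linear0 => /esym/eqP.
by rewrite scaler_eq0 (negPf card_low_neq0) => /eqP.
Qed.

(* Since h e_mu is a multiple of e_mu, the right factor can be moved across the
   pairing as its transpose, which leaves e_mu^T A e_la on the left and e_mu on
   the right; by von Neumann's lemma this is at most one-dimensional. *)
Lemma elt_pair_eq la mu x y : largest_part mu = (n - k)%N ->
    (x \in galg)%MS -> (y \in galg)%MS ->
  exists c, elt (pair (x *m young la) (y *m young mu))
    = c *: elt (pair (col_alt mu *m young mu) (young mu)).
Proof.
move=> mu_1 Ax Ay; have Al := young_galg F la; have Am := young_galg F mu.
have Ah : (h \in galg)%MS by exact: sym_sum_galg.
have le_mu : (n - k <= largest_part mu)%N by rewrite mu_1.
have step (z w : 'M[F]_N) : (z \in galg)%MS -> (w \in galg)%MS ->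
    #|H|%:R *: elt (pair z (w *m young mu)) = elt (pair (w^T *m h *m z) (young mu)).
  move=> Az Aw; rewrite -rook_elt_swap // -mulmxA sym_low_young // -scalemxAr.
  by rewrite group_pairZr linearZ.
have [c c_neq0 sq_e] := young_sq fact_neq0 mu.
pose x1 := y^T *m h *m x.
have Ax1 : (x1 \in galg)%MS by rewrite !galgM ?galg_tr.
have [d Ed] : exists d, (young mu)^T *m (h *m x1) *m young la = d *: (col_alt mu *m young mu).
  have [eq_la|neq_la] := pselect (la = mu); last first.
    by exists 0; rewrite scale0r tr_young_neq // galgM.
  have [d Ed] := @row_col_scalar F n fact_neq0 mu (h *m x1 *m row_sym mu)
    (galgM (galgM Ah Ax1) (row_sym_galg F mu)).
  exists d; rewrite eq_la trmx_young scalemxAr -Ed.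
  by have -> : young mu = row_sym mu *m col_alt mu by []; rewrite !mulmxA.
have E1 : #|H|%:R *: elt (pair (x *m young la) (y *m young mu))
    = elt (pair (x1 *m young la) (young mu)).
  by rewrite (step _ _ (galgM Ax Al) Ay) mulmxA.
(* The square provides a second [young mu] to move across; it is removed again in [E3] by dividing
   by [c]. *)
have E2 : #|H|%:R *: elt (pair (x1 *m young la) (young mu *m young mu))
    = d *: elt (pair (col_alt mu *m young mu) (young mu)).
  rewrite (step _ _ (galgM Ax1 Al) Am) -linearZ -group_pairZl -Ed.
  by rewrite !mulmxA.
have E3 : (#|H|%:R * c * #|H|%:R) *: elt (pair (x *m young la) (y *m young mu))
    = d *: elt (pair (col_alt mu *m young mu) (young mu)).
  by rewrite -E2 sq_e group_pairZr [elt (_ *: _)]linearZ /= -E1 !scalerA.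
exists ((#|H|%:R * c * #|H|%:R)^-1 * d); rewrite -scalerA -E3 scalerA.
by rewrite mulVf ?scale1r // !mulf_neq0 ?card_low_neq0.
Qed.

(** Addition avoids truncated subtraction: for [k > n] no shape qualifies. *)
Definition comp_index la := (largest_part la + k == n)%N.

Lemma comp_index_largest la : comp_index la -> largest_part la = (n - k)%N.
Proof. by move=> /eqP la_k; apply/eqP; rewrite -(eqn_add2r k) la_k subnK. Qed.

Local Notation comp_space la := 'rV[F]_(rdegree (outer_repr (irrS F la) (irrS F la))).

Definition comp_sum (q : mxquot F n) := exists v : forall la, comp_space la,
  q = \sum_(la <- [seq la <- index_enum (intpart n) | comp_index la]) comp_map (v la).

Lemma comp_sumP a q q' : comp_sum q -> comp_sum q' -> comp_sum (a *: q + q').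
Proof.
move=> [v ->] [v' ->]; exists (fun la => a *: v la + v' la).
rewrite scaler_sumr -big_split; apply: eq_bigr => la _ /=.
by rewrite linearP.
Qed.

Lemma comp_sum0 : comp_sum 0.
Proof. by exists (fun=> 0); rewrite big1 // => la _; rewrite linear0. Qed.

Lemma comp_sum_map la (v : comp_space la) : comp_index la -> comp_sum (comp_map v).
Proof.
move=> la_k; exists (dfwith (fun mu => 0 : comp_space mu) v); rewrite (bigD1_seq la) /=.
- rewrite dfwith_in big1 ?addr0 // => mu neq_mu; rewrite dfwith_out ?linear0 //.
  by rewrite eq_sym.
- by rewrite mem_filter la_k mem_index_enum.
- by rewrite filter_uniq // index_enum_uniq.
Qed.

(** By [young_ind] in both factors it suffices to treat [rho s young la rho t] and
    [rho s' young mu rho t']. The outer [t], [t'] act as a group element, and the size of the first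
    part of [mu] decides between 0 and a multiple of the generator for [mu]. *)
Lemma comp_sum_elt M : comp_sum (elt M).
Proof.
move: M; apply: group_pair_span => [a M M' SM SM'||s t]; last 1 first.
- move: (rho s) (rho_galg F s) (rho t) (rho_galg F t) => {s t}; apply: (young_ind fact_neq0 i0).
  + by move=> a x x' Sx Sx' y Ay; rewrite group_pairDl linearP /=; apply: comp_sumP; auto.
  + by move=> y _; rewrite group_pair0l linear0; exact: comp_sum0.
  move=> la s t; apply: (young_ind fact_neq0 i0).
  + by move=> a y y' Sy Sy'; rewrite group_pairDr linearP /=; apply: comp_sumP; auto.
  + by rewrite group_pair0r linear0; exact: comp_sum0.
  move=> mu s' t'; rewrite group_pair_mul -(rook_elt_act _ (t, t')).
  case: (ltngtP (largest_part mu) (n - k)) => [lt_mu|lt_mu|mu_1].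
  + rewrite (elt_pair_low lt_mu (galgM (rho_galg F s) (young_galg F la)) (rho_galg F s')).
    by rewrite linear0; exact: comp_sum0.
  + rewrite (elt_pair_high lt_mu (galgM (rho_galg F s) (young_galg F la)) (rho_galg F s')).
    by rewrite linear0; exact: comp_sum0.
  have [c ->] := elt_pair_eq la mu_1 (rho_galg F s) (rho_galg F s').
  rewrite linearZ /= rook_elt_act -group_pair_mul /=.
  have [v <-] := comp_map_pair mu (rho_galg F t) (rho_galg F t').
  rewrite -[_ *: _]addr0; apply: comp_sumP; last exact: comp_sum0.
  by apply: comp_sum_map; rewrite /comp_index mu_1 subnK.
- by rewrite linearP; exact: comp_sumP.
- by rewrite linear0; exact: comp_sum0.
Qed.

(** The kernel of [elt] is stable under the group action, hence under pairs of group algebra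
    elements. *)
Lemma elt_sandwich M : elt M = 0 ->
  forall x, (x \in galg)%MS -> forall y, (y \in galg)%MS -> elt (x^T *m M *m y) = 0.
Proof.
move=> M0; apply: galg_ind => [a x x' Ex Ex' y Ay||s].
- by rewrite linearP /= !mulmxDl -!scalemxAl linearP /= Ex ?Ex' // scaler0 addr0.
- by move=> y _; rewrite trmx0 !mul0mx linear0.
apply: galg_ind => [a y y' Ey Ey'||t].
- by rewrite mulmxDr -scalemxAr linearP /= Ey Ey' scaler0 addr0.
- by rewrite mulmx0 linear0.
by rewrite -(rook_elt_act _ (s, t)) M0 linear0.
Qed.

Lemma basis_mul_young_neq la mu x : la <> mu -> (x \in galg)%MS ->
  row_base (cyclic_mx (regular_repr F G) (young_symmetrizer F la)) *m (x *m young mu) = 0.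
Proof.
move=> neq_la Ax; apply/row_matrixP => i; rewrite row_mul row0.
have [y Ay ->] := row_module_basis i.
by rewrite -gring_row_mul mulmxA -(mulmxA (young la)) young_neq ?linear0 // galgM.
Qed.

(** By [young_scalar], each row of the product is a multiple of the row of [young mu]; [w] collects
    the factors. *)
Lemma basis_mul_young mu x : (x \in galg)%MS ->
  exists w : 'cV_(\rank (cyclic_mx (regular_repr F G) (young_symmetrizer F mu))),
    row_base (cyclic_mx (regular_repr F G) (young_symmetrizer F mu)) *m (x *m young mu)
    = w *m row (young mu).
Proof.
move=> Ax; set U := row_base _.
have coefP i : {c : F | matrix.row i U *m (x *m young mu) = c *: row (young mu)}.
  apply: cid; have [y Ay ->] := row_module_basis i.
  have [c Ec] := young_scalar fact_neq0 mu (galgM Ay Ax); exists c.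
  by rewrite -gring_row_mul -linearZ -Ec /= !mulmxA.
exists (\col_i sval (coefP i)); apply/row_matrixP => i.
rewrite row_mul (svalP (coefP i)) [RHS]row_mul; apply/rowP => j.
by rewrite !mxE big_ord1 !mxE.
Qed.

Lemma trmx_sandwich m1 m2 p1 p2 q1 q2 (A : 'M[F]_(p1, q1)) (B : 'M[F]_(p2, q2))
    (C : 'M[F]_(m1, p1)) (X : 'M[F]_(m1, m2)) (D : 'M[F]_(m2, p2)) :
  A^T *m (C^T *m X *m D) *m B = (C *m A)^T *m X *m (D *m B).
Proof. by rewrite trmx_mul !mulmxA. Qed.

Lemma trmx_scalar_sandwich m1 m2 p1 p2 (u : 'cV[F]_m1) (r : 'rV[F]_p1) (X : 'M[F]_(m1, m2))
    (w : 'cV[F]_m2) (r' : 'rV[F]_p2) :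
  (u *m r)^T *m X *m (w *m r') = (u^T *m X *m w) 0 0 *: (r^T *m r').
Proof.
rewrite trmx_mul; transitivity (r^T *m (u^T *m X *m w) *m r'); first by rewrite !mulmxA.
by rewrite [X in _ *m X *m _]mx11_scalar mul_mx_scalar -scalemxAl.
Qed.

(** Multiplication by [x young mu] and [y young mu] isolates the term of [mu] and reduces it to a
    scalar times the nonzero class of [comp_gen_neq0]. The scalar vanishes for all [x] and [y], and
    [young_ind] then removes both multipliers. *)
Lemma comp_maps_independent (v : forall la, comp_space la) :
  \sum_(la <- [seq la <- index_enum (intpart n) | comp_index la]) comp_map (v la) = 0 ->
  forall mu, comp_index mu -> v mu = 0.
Proof.
move=> sum0 mu mu_k; have mu_1 := comp_index_largest mu_k.
pose U la := row_base (cyclic_mx (regular_repr F G) (young_symmetrizer F la)).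
pose X la := tens_coord (v la).
have sandwich x y : (x \in galg)%MS -> (y \in galg)%MS ->
    (U mu *m (x *m young mu))^T *m X mu *m (U mu *m (y *m young mu)) = 0.
  move=> Ax Ay; have [w Ew] := basis_mul_young mu Ax; have [w' Ew'] := basis_mul_young mu Ay.
  rewrite -/(U mu) in Ew Ew'.
  have M0 : elt (\sum_(la <- [seq la <- index_enum (intpart n) | comp_index la])
      (U la *m lmul (col_alt la))^T *m X la *m U la) = 0.
    by rewrite linear_sum.
  have := elt_sandwich M0 (galgM Ax (young_galg F mu)) (galgM Ay (young_galg F mu)).
  rewrite mulmx_sumr mulmx_suml (bigD1_seq mu) /=; last 2 first.
  - by rewrite mem_filter mu_k mem_index_enum.
  - by rewrite filter_uniq // index_enum_uniq.
  rewrite big1 ?addr0 => [|la neq_la]; last first.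
    rewrite -(mulmxA (x *m young mu)^T) -(mulmxA _ (U la)) basis_mul_young_neq ?mulmx0 // => eq_la.
    by rewrite eq_la eqxx in neq_la.
  rewrite trmx_sandwich.
  have -> : U mu *m lmul (col_alt mu) *m (x *m young mu)
      = U mu *m (x *m young mu) *m lmul (col_alt mu).
    by rewrite -[RHS]mulmxA -(lmul_galg _ (galgM Ax (young_galg F mu))) [RHS]mulmxA.
  rewrite Ew Ew'.
  rewrite -(mulmxA w) row_lmul ?young_galg // !trmx_scalar_sandwich -/(pair _ _).
  rewrite linearZ /= => /eqP; rewrite scaler_eq0 (negPf (comp_gen_neq0 mu_1)) orbF => /eqP ->.
  by rewrite scale0r.
have right0 x : (x \in galg)%MS -> (U mu *m (x *m young mu))^T *m X mu *m U mu = 0.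
  move=> Ax; rewrite -[LHS]mulmx1; move: (1%:M) (galg1 F n); apply: (young_ind fact_neq0 i0).
  - by move=> a y y' Ey Ey'; rewrite mulmxDr -scalemxAr Ey Ey' scaler0 addr0.
  - by rewrite mulmx0.
  move=> la s t; rewrite mulmxA -(mulmxA _ (U mu)).
  have [->|neq_la] := pselect (la = mu); first by rewrite sandwich ?rho_galg ?mul0mx.
  have neq_mu : mu <> la by move=> eq_mu; exact: neq_la.
  by rewrite (basis_mul_young_neq neq_mu) ?rho_galg ?mulmx0 ?mul0mx.
have U0 : (U mu)^T *m X mu *m U mu = 0.
  rewrite -[LHS]mul1mx -[1%:M]trmx1.
  move: (1%:M) (galg1 F n); apply: (young_ind fact_neq0 i0).
  - by move=> a y y' Ey Ey'; rewrite linearP /= mulmxDl -scalemxAl Ey Ey' scaler0 addr0.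
  - by rewrite trmx0 mul0mx.
  move=> la s t; rewrite trmx_mul -(mulmxA (rho t)^T).
  have -> : (rho s *m young la)^T *m ((U mu)^T *m X mu *m U mu)
     = (U mu *m (rho s *m young la))^T *m X mu *m U mu by rewrite [in RHS]trmx_mul !mulmxA.
  have [->|neq_la] := pselect (la = mu); first by rewrite right0 ?rho_galg ?mulmx0.
  have neq_mu : mu <> la by move=> eq_mu; exact: neq_la.
  by rewrite (basis_mul_young_neq neq_mu) ?rho_galg ?trmx0 ?mul0mx ?mulmx0.
(* The rows of [U mu] are independent, so a right inverse recovers [X mu] from [U0]. *)
have /row_freeP[B UB] : row_free (U mu) by exact: row_base_free.
apply: tens_coord_inj; rewrite [RHS]linear0 -/(X mu).
have := congr1 (fun Y => B^T *m Y *m B) U0; rewrite /= mulmx0 mul0mx.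
by rewrite trmx_sandwich UB trmx1 mul1mx mulmx1.
Qed.
End Components.

(** * Identification of the degree k piece *)

Lemma mxquot_degree_comp_sum (F : fieldType) (n k : nat) (fact_neq0 : (n`!)%:R != 0 :> F)
    (i0 : 'I_n) (q : mxquot F n) :
  mxquot_degree k q <-> comp_sum k q.
Proof.
have [le_kn|lt_nk] := leqP k n.
  split; first move: q.
    apply: mxquot_degree_ind => [a q q' Sq Sq'||c size_c uniq1 uniq2].
    - exact: comp_sumP.
    - exact: comp_sum0.
    have [M <-] := rook_elt_surj F le_kn i0 size_c uniq1 uniq2.
    exact: comp_sum_elt.
  move=> [v ->]; rewrite /comp_map -linear_sum; exact: rook_elt_degree.
(* For [k > n] both sides hold only for 0: the index set is empty. *)
split=> [/mxquot_degree_gt_eq0 -> //|[v ->]]; first exact: comp_sum0.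
rewrite big_seq big1 => [|la]; first by exists 0; rewrite ?raddf0 ?rpred0.
rewrite mem_filter => /andP[/eqP la_k _]; move: lt_nk.
by rewrite -{1}la_k ltnNge leq_addl.
Qed.

Theorem theorem4p2 (F : fieldType) (n : nat) (n_gt0 : (0 < n)%N)
    (charF : forall p : nat, p \in [pchar F] -> (n < p)%N) (k : nat) :
  let W : representation F [set: 'S_n * 'S_n]%G :=
    \big[dadd_grepr/grepr0]_(la : intpart n | (largest_part la + k)%N == n)
       outer_repr (irrS F la) (irrS F la) in
  exists phi : {linear 'rV[F]_(rdegree W) -> mxquot F n},
    [/\ injective phi,
        forall q : mxquot F n,
          mxquot_degree k q <-> exists v : 'rV[F]_(rdegree W), phi v = q
      & forall (g : 'S_n * 'S_n) (v : 'rV[F]_(rdegree W)),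
          phi (v *m W g) = mxquot_act g (phi v)].
Proof.
have fact_neq0 : (n`!)%:R != 0 :> F.
  elim: {-2}n (leqnn n) => [|m IHm] lt_mn; first by rewrite oner_eq0.
  rewrite factS natrM; apply: mulf_neq0; last exact: IHm (ltnW lt_mn).
  apply/negP => m0.
  (* A vanishing factor would make the characteristic a prime dividing [m + 1 <= n], against
     [charF]. *)
  have [p pF] := natf0_pchar (ltn0Sn m) m0; move: m0; rewrite -(dvdn_pcharf pF).
  move=> /(dvdn_leq (ltn0Sn m)) le_p.
  by have := leq_trans (charF p pF) (leq_trans le_p lt_mn); rewrite ltnn.
move=> W; pose i0 := Ordinal n_gt0.
pose r := [seq la <- index_enum (intpart n) | comp_index k la].
have r_uniq : uniq r by rewrite filter_uniq // index_enum_uniq.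
have [] := @dadd_grepr_map F _ [set: 'S_n * 'S_n]%G (mxquot F n) (intpart n) (@mxquot_act F n)
  (fun la => outer_repr (irrS F la) (irrS F la)) (fun la => @comp_map F n k la)
  (@mxquot_act_is_linear F n) (fun la g v => comp_map_equiv k g v) r r_uniq.
rewrite big_filter -/W => Phi [Phi_equiv Phi_im Phi_inj].
exists Phi; split=> [|q|g v]; last exact: Phi_equiv.
- apply: Phi_inj => v sum0 la; rewrite mem_filter => /andP[la_k _].
  have le_kn : (k <= n)%N by rewrite -(eqP la_k) leq_addl.
  exact: (comp_maps_independent fact_neq0 i0 le_kn sum0).
- rewrite (mxquot_degree_comp_sum k fact_neq0 i0); exact: iff_sym (Phi_im q).
Qed.
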